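(* Let $X=(X_s)_{s\ge 0}$ be a subordinator with drift $d\ge 0$ and Lévy measure $\Pi$. Assume that either $\Pi(0,\infty)=\infty$, or $\Pi(0,\infty)<\infty$ and $d>0$. Then for every $t>0$, almost surely, $$\lim_{\delta\to 0}U(\delta)\,N(t,\delta)=t .$$
   Context: A subordinator is a non-decreasing Lévy process $X$ with $X_0=0$, with $\mathbb{E}[e^{-\lambda X_t}]=e^{-t\Phi(\lambda)}$ for $\lambda>0$, where $\Phi(\lambda)=d\lambda+\int_0^\infty(1-e^{-\lambda y})\Pi(dy)$, $d\ge 0$ is the drift, and $\Pi$ is a measure on $(0,\infty)$ with $\int_0^\infty\min\{1,x\}\Pi(dx)<\infty$. (The assumption on $\Pi$ and $d$ is equivalent to $X$ not being a compound Poisson process.) For $t>0$, $\delta>0$, $N(t,\delta)$ is the minimal number of intervals of length at most $\delta$ needed to cover the range $\{X_s:0\le s\le t\}$. The potential function is $U(\delta)=\int_0^\infty\mathbb{P}(X_t\le\delta)\,dt=\mathbb{E}[T_1(\delta)]$, where $T_1(\delta)=\inf\{t\ge 0: X_t>\delta\}$. *)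

(* Defs.v *)
From HB Require Import structures.
From mathcomp Require Import all_boot all_order all_algebra.
From mathcomp Require Import all_classical all_reals all_analysis.

Set Implicit Arguments.
Unset Strict Implicit.
Unset Printing Implicit Defensive.

Import Order.TTheory GRing.Theory Num.Theory.
Import numFieldNormedType.Exports.

Local Open Scope classical_set_scope.
Local Open Scope ring_scope.

(* The product rule is required for the whole family only; taking some of the
   [B i] to be [setT] yields it for every subfamily. *)
Definition independent_RVs (disp : measure_display) (T : measurableType disp)
    (R : realType) (P : probability T R) (n : nat)
    (Y : 'I_n -> T -> R) : Prop :=
  forall B : 'I_n -> set R, (forall i, measurable (B i)) ->
    P (\bigcap_i (Y i @^-1` B i)) = (\prod_(i < n) P (Y i @^-1` B i))%E.

(* Processes are indexed by all of [R], but only the times [0 <= t] are ever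
   constrained or used.  Path properties are required almost surely. *)
Record levy_process (disp : measure_display) (T : measurableType disp)
    (R : realType) (P : probability T R) (X : R -> {RV P >-> R}) : Prop := {
  levy_start : {ae P, forall w, X 0 w = 0};
  levy_independent_increments :
    forall (n : nat) (s : nat -> R), 0 <= s 0%N -> increasing_seq s ->
      independent_RVs P (fun i : 'I_n => X (s i.+1) \- X (s i));
  levy_stationary_increments :
    forall (s h : R) (B : set R), 0 <= s -> 0 <= h -> measurable B ->
      P ((X (s + h) \- X s) @^-1` B) = P (X h @^-1` B);
  levy_right_continuous :
    {ae P, forall w, forall t : R, 0 <= t -> X s w @[s --> t^'+] --> X t w};
  levy_left_limits :
    {ae P, forall w, forall t : R, 0 < t -> cvg (X s w @[s --> t^'-])} }.

(* A measure on (0, oo) is represented by a measure on R vanishing on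
   ]-oo, 0]. *)
Record subordinator_levy_measure (R : realType)
    (Pi : {measure set (measurableTypeR R) -> \bar R}) : Prop := {
  levy_measure_support : Pi `]-oo, 0]%classic = 0%E;
  levy_measure_integrability :
    (\int[Pi]_(x in `]0%R, +oo[) (Num.min 1 x)%:E < +oo)%E }.

Definition laplace_exponent (R : realType) (d : R)
    (Pi : {measure set (measurableTypeR R) -> \bar R}) (lambda : R) : \bar R :=
  ((d * lambda)%:E +
    \int[Pi]_(y in `]0%R, +oo[) (1 - expR (- (lambda * y)))%:E)%E.

Record subordinator (disp : measure_display) (T : measurableType disp)
    (R : realType) (P : probability T R) (X : R -> {RV P >-> R}) (d : R)
    (Pi : {measure set (measurableTypeR R) -> \bar R}) : Prop := {
  subordinator_levy : levy_process X;
  subordinator_nondecreasing :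
    {ae P, forall w, forall s t : R, 0 <= s -> s <= t -> X s w <= X t w};
  subordinator_drift_ge0 : 0 <= d;
  subordinator_levy_measureP : subordinator_levy_measure Pi;
  subordinator_laplace : forall t lambda : R, 0 <= t -> 0 < lambda ->
    ('E_P[fun w => expR (- (lambda * X t w))%R]
      = expeR (- (t%:E * laplace_exponent d Pi lambda)))%E }.

(* Arbitrary (open, closed, half-open) intervals are allowed; the Lebesgue
   measure of an interval is its length. *)
Definition interval_cover (R : realType) (A : set R) (delta : R) (n : nat) :
    Prop :=
  exists I : 'I_n -> interval R,
    (forall i, (lebesgue_measure ([set` I i] : set R) <= delta%:E)%E) /\
    A `<=` \bigcup_i [set` I i].

(* The value is +oo when there is no finite cover, and otherwise the least [n]
   for which a cover by [n] intervals exists. *)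
Definition covering_number (R : realType) (A : set R) (delta : R) : \bar R :=
  ereal_inf [set n%:R%:E | n in [set n : nat | interval_cover A delta n]].

Definition range_covering_number (disp : measure_display)
    (T : measurableType disp) (R : realType) (P : probability T R)
    (X : R -> {RV P >-> R}) (t delta : R) (w : T) : \bar R :=
  covering_number [set X s w | s in `[0, t]] delta.

Definition potential (disp : measure_display) (T : measurableType disp)
    (R : realType) (P : probability T R) (X : R -> {RV P >-> R}) (delta : R) :
    \bar R :=
  (\int[lebesgue_measure]_(t in `[0%R, +oo[) P [set w | (X t w <= delta)%R])%E.

(* Main.v *)
(* The greedy cover of the range starts a new interval at each first passage
   more than delta above the last starting point, so N(t, delta) counts the
   renewals up to time t of a renewal process whose mean waiting time is
   U(delta).  Sampling X at the times i h replaces this by the number of blocks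
   C of a random walk, and no stopping time is needed: if V(y) is the mean time
   left in a block of which y has been used, and mu = V(0), then
   V(y_n) - mu C_n + n is a martingale with E[(V(y_n) - mu C_n + n - mu)^2] at
   most 2 n mu.  Chebyshev's inequality bounds
   P(|U(delta) N(t, delta) - t| > e t) by a multiple of U(delta) uniformly in
   h, and the bound survives h -> 0.  A Chernoff bound on the Laplace transform
   shows that U is finite and tends to 0, and U is continuous; so
   Borel-Cantelli applies along a sequence on which U decays geometrically with
   ratio close to 1, and monotonicity in delta fills the gaps. *)
Require Import Defs.
From mathcomp Require Import all_boot all_order all_algebra.
From mathcomp Require Import all_classical all_reals all_analysis.
From mathcomp Require Import measurable_realfun ring lra zify.

Set Implicit Arguments.
Unset Strict Implicit.
Unset Printing Implicit Defensive.

Import Order.TTheory GRing.Theory Num.Theory.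
Import numFieldNormedType.Exports.

Local Open Scope classical_set_scope.
Local Open Scope ring_scope.

(** * Independence and recursive chains *)

(** The assumption on [Pi] and [d] enters only through the unboundedness of the Laplace exponent: it
    lets the Chernoff bound give exponential decay of P(X_t <= a) at any prescribed rate [M]. For a
    compound Poisson process P(X_t = 0) decays at a fixed rate, U(0+) > 0, and the blocks do not
    become short. The second moment of the martingale is computed without conditional expectations:
    the block state is a recursively defined chain, independent of the next increment, so each step
    is one integral against the law of that increment. Continuity of U serves to realise every value
    of the geometric sequence exactly; a jump of U could keep the ratio of consecutive values away
    from 1, and monotonicity could then not fill the gaps. *)

Section independence.
Context (disp : measure_display) (T : measurableType disp) (R : realType)
  (P : probability T R).
Local Open Scope ereal_scope.

Lemma finite_measure_prod_unique (d1 d2 : measure_display)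
    (T1 : measurableType d1) (T2 : measurableType d2)
    (m1 m2 : {measure set (T1 * T2) -> \bar R}) :
  m1 setT < +oo ->
  (forall A B, measurable A -> measurable B -> m1 (A `*` B) = m2 (A `*` B)) ->
  forall D, measurable D -> m1 D = m2 D.
Proof.
move=> m1oo m12 D mD.
apply: (measure_unique [set A `*` B | A in measurable & B in measurable]
  (fun=> setT)) => //.
- exact: measurable_prod_measurableType.
- move=> _ _ [A mA [B mB <-]] [A' mA' [B' mB' <-]].
  by exists (A `&` A'); [exact: measurableI|exists (B `&` B');
    [exact: measurableI|rewrite setXI]].
- by move=> _; exists setT => //; exists setT => //; rewrite setXTT.
- by rewrite bigcup_const//; exists 0%N.
- by move=> _ [A mA [B mB <-]]; exact: m12.
Qed.

Definition independent_pair (d1 d2 : measure_display)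
    (T1 : measurableType d1) (T2 : measurableType d2)
    (A : T -> T1) (Z : T -> T2) : Prop :=
  forall a b, measurable a -> measurable b ->
    P (A @^-1` a `&` Z @^-1` b) = P (A @^-1` a) * P (Z @^-1` b).

(** Independence makes the joint law the product of the laws, so Tonelli integrates out [Z] with [A]
    frozen. This is the substitute for conditioning on [A]. *)
Lemma integral_independent_pair (d1 d2 : measure_display)
    (T1 : measurableType d1) (T2 : measurableType d2)
    (A : {mfun T >-> T1}) (Z : {mfun T >-> T2}) (f : T1 * T2 -> \bar R) :
  independent_pair A Z -> measurable_fun setT f -> (forall z, 0 <= f z) ->
  \int[P]_w f (A w, Z w) =
  \int[P]_w \int[distribution P Z]_x f (A w, x).
Proof.
move=> indep mf f0.
have mAZ : measurable_fun setT (fun w => (A w, Z w)).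
  exact: measurable_fun_pair.
pose AZ : {mfun T >-> (T1 * T2)%type} := mfun_Sub (mem_set mAZ).
transitivity (\int[distribution P AZ]_z f z).
  by rewrite ge0_integral_distribution.
transitivity (\int[distribution P A \x distribution P Z]_z f z).
  apply: eq_measure_integral => D mD _.
  by symmetry; apply: product_measure_unique.
rewrite fubini_tonelli1// /fubini_F ge0_integral_distribution//.
- exact: measurable_fun_fubini_tonelli_F.
- by move=> y; exact: integral_ge0.
Qed.


Variable xi : nat -> {mfun T >-> R}.
Hypothesis xi_indep : forall n, independent_RVs P (fun i : 'I_n => xi i).

Lemma prob_future (j m : nat) (B : nat -> set R) :
  (forall i, measurable (B i)) ->
  P (\big[setI/setT]_(j <= i < j + m) (xi i @^-1` B i)) =
  \prod_(j <= i < j + m) P (xi i @^-1` B i).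
Proof.
move=> mB.
pose B' i := if (j <= i)%N then B i else setT.
have mB' i : measurable (B' i) by rewrite /B'; case: ifP.
have := @xi_indep (j + m) (fun i => B' i) (fun i => mB' i).
have -> : \bigcap_(i in [set: 'I_(j + m)]) (xi i @^-1` B' i) =
   \big[setI/setT]_(0 <= i < j + m) (xi i @^-1` B' i).
  rewrite big_mkord -(bigcap_mkord _ (fun i => xi i @^-1` B' i)).
  apply/seteqP; split=> [w h i /= im|w h i _].
    exact: (h (Ordinal im)).
  exact: (h i (ltn_ord i)).
rewrite -(big_mkord xpredT (fun i => P (xi i @^-1` B' i))).
rewrite (big_cat_nat (leq0n j) (leq_addr m j))/= big_nat_cond big1; last first.
  by move=> i /andP[/andP[_ ij] _]; rewrite /B' leqNgt ij/= preimage_setT.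
rewrite setTI [X in _ = X -> _](big_cat_nat (leq0n j) (leq_addr m j))/=.
rewrite [X in _ = X * _ -> _]big_nat_cond [X in _ = X * _ -> _]big1; last first.
  move=> i /andP[/andP[_ ij] _]; rewrite /B' leqNgt ij/= preimage_setT.
  exact: probability_setT.
rewrite mul1e => h.
have e1 (F : nat -> set R -> set T) : \big[setI/setT]_(j <= i < j + m) F i (B i) =
          \big[setI/setT]_(j <= i < j + m) F i (B' i).
  by apply: eq_big_nat => i /andP[ji _]; rewrite /B' ji.
rewrite (e1 (fun i b => xi i @^-1` b)) h.
by apply: eq_big_nat => i /andP[ji _]; rewrite /B' ji.
Qed.

Context (dS : measure_display) (S : measurableType dS) (phi : S -> R -> S)
  (s0 : S).
Hypothesis mphi : measurable_fun setT (fun p : S * R => phi p.1 p.2).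

(** The state space is arbitrary because two chains are driven by the same increments: the random
    walk and the block state. *)
Fixpoint chain (n : nat) (w : T) : S :=
  if n is m.+1 then phi (chain m w) (xi m w) else s0.

Lemma measurable_chain n : measurable_fun setT (chain n).
Proof.
elim: n => [|n IH]; first exact: measurable_cst.
rewrite (_ : chain n.+1 = (fun p : S * R => phi p.1 p.2) \o
  (fun w => (chain n w, xi n w)))//.
by apply: measurableT_comp => //; exact: measurable_fun_pair.
Qed.

(* The future increments are part of the statement to make the induction on
   [j] go through. *)
Lemma chain_future_indep j m (A : set S) (B : nat -> set R) :
  measurable A -> (forall i, measurable (B i)) ->
  P (chain j @^-1` A `&` \big[setI/setT]_(j <= i < j + m) (xi i @^-1` B i)) =
  P (chain j @^-1` A) * \prod_(j <= i < j + m) P (xi i @^-1` B i).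
Proof.
elim: j m A B => [|j IH] m A B mA mB.
  rewrite -prob_future//; have [s0A|s0A] := pselect (A s0).
    rewrite (_ : chain 0 @^-1` A = setT) ?setTI ?probability_setT ?mul1e//.
    by apply/seteqP; split.
  rewrite (_ : chain 0 @^-1` A = set0) ?set0I ?measure0 ?mul0e//.
  by apply/seteqP; split.
set E := \big[setI/setT]_(j.+1 <= i < j.+1 + m) _.
have mE : measurable E.
  apply: bigsetI_measurable => i _.
  by rewrite -[_ @^-1` _]setTI; exact: measurable_funP.
have mpair : measurable_fun setT (fun w => (chain j w, xi j w)).
  by apply: measurable_fun_pair => //; exact: measurable_chain.
pose p : {nonneg R} := NngNum (fine_ge0 (measure_ge0 P E)).
have pE : (fine (P E))%:E = P E by rewrite fineK// fin_num_measure.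
have PE : P E = \prod_(j.+1 <= i < j.+1 + m) P (xi i @^-1` B i).
  exact: prob_future.
(* The instances are named explicitly because unification cannot find the
   measurability proof they take as an argument. *)
pose m1 := measure_function_pushforward__canonical__measure_function_Measure
  (mrestr P mE) mpair.
pose m2 := measure_function_pushforward__canonical__measure_function_Measure
  P mpair.
have m1E D : m1 D = P ((fun w => (chain j w, xi j w)) @^-1` D `&` E) by [].
have m2E D : mscale p m2 D = P E * P ((fun w => (chain j w, xi j w)) @^-1` D).
  by rewrite -[in RHS]pE.
(* The preimage of [A] under [phi] is not a rectangle, so the factorisation is first proved on
   rectangles, from the induction hypothesis, and then extended to all measurable sets. *)
have key := finite_measure_prod_unique (m1 := m1) (m2 := mscale p m2).
have {}key : forall D, measurable D -> m1 D = mscale p m2 D.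
  apply: key.
    rewrite /m1/= /pushforward/= /mrestr preimage_setT setTI.
    by rewrite (le_lt_trans (probability_le1 P mE))// ltry.
  move=> a b ma mb; rewrite m1E; apply: (etrans _ (esym (m2E _))).
  have rect : (fun w => (chain j w, xi j w)) @^-1` (a `*` b) =
    chain j @^-1` a `&` xi j @^-1` b by apply/seteqP; split.
  rewrite rect.
  pose B' i := if i == j then b else B i.
  have mB' i : measurable (B' i) by rewrite /B'; case: eqP.
  have := IH m.+1 a B' ma mB'.
  rewrite addnS big_ltn ?ltnS ?leq_addr// [X in _ = _ * X]big_ltn ?ltnS ?leq_addr//.
  have -> : \big[setI/setT]_(j.+1 <= i < (j + m).+1) (xi i @^-1` B' i) = E.
    by apply: eq_big_nat => i /andP[ji _]; rewrite /B' gtn_eqF.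
  have -> : \prod_(j.+1 <= i < (j + m).+1) P (xi i @^-1` B' i) = P E.
    by rewrite PE; apply: eq_big_nat => i /andP[ji _]; rewrite /B' gtn_eqF.
  rewrite setIA {1 2}/B' eqxx => ->.
  have := IH 1%N a B' ma mB'.
  rewrite addn1 !big_nat1 /B' eqxx => ->.
  by rewrite muleA muleC.
have := key ((fun p : S * R => phi p.1 p.2) @^-1` A).
rewrite -[X in measurable X]setTI => /(_ (mphi measurableT mA)).
rewrite m1E => /(fun h => etrans h (m2E _)); rewrite PE => e.
by rewrite [RHS]muleC; exact: e.
Qed.

Lemma chain_indep j : independent_pair (chain j) (xi j).
Proof.
move=> a b ma mb.
have := @chain_future_indep j 1 a (fun=> b) ma (fun=> mb).
by rewrite addn1 !big_nat1.
Qed.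

End independence.

(** * Covering numbers and greedy blocks *)

Section separated_points.
Context (R : realType).
Implicit Types (A : set R) (delta : R).

Definition separated delta : rel R := [rel x y | x + delta < y].

Lemma separated_trans delta : 0 <= delta -> transitive (separated delta).
Proof. by move=> d0 y x z; rewrite /separated/= => xy yz; lra. Qed.

Lemma length_lt_separated (I : interval R) delta x y :
  (lebesgue_measure ([set` I] : set R) <= delta%:E)%E ->
  x \in I -> y \in I -> ~~ separated delta x y.
Proof.
move=> Id xI yI; rewrite /separated/= -leNgt leNgt; apply/negP => xy.
have [yx|{}xy'] := leP y x.
  have : (0%:E <= delta%:E)%E by exact: le_trans (measure_ge0 _ _) Id.
  by rewrite lee_fin; lra.
have sub : `[x, y]%classic `<=` [set` I].
  move=> z /=; rewrite in_itv/= => xzy.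
  exact: (@interval_is_interval R I x y xI yI z xzy).
have : (lebesgue_measure `[x, y]%classic <= delta%:E)%E.
  by apply: le_trans Id; apply: le_measure; rewrite ?inE.
by rewrite lebesgue_measure_itv/= lte_fin xy' -EFinB lee_fin; lra.
Qed.

(** Pigeonhole: no interval of length at most [delta] contains two of the separated points. *)
Lemma interval_cover_separated A delta n x l : 0 <= delta ->
  interval_cover A delta n -> path (separated delta) x l ->
  (forall z, z \in x :: l -> A z) -> (size l < n)%N.
Proof.
move=> d0 [I [Id AI]] xl lA; rewrite ltnNge; apply/negP => nl.
have ex (i : 'I_(size l).+1) : exists j, nth 0 (x :: l) i \in I j.
  have /lA/AI[j _ jI] : nth 0 (x :: l) i \in x :: l by rewrite mem_nth.
  by exists j.
pose f (i : 'I_(size l).+1) := sval (cid (ex i)).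
have fP (i : 'I_(size l).+1) : nth 0 (x :: l) i \in I (f i) by rewrite /f; case: cid.
have finj : injective f.
  move=> i j fij; apply/val_inj/eqP; rewrite /= eqn_leq; apply: contraT.
  rewrite negb_and -!ltnNge.
  have key (a b : 'I_(size l).+1) : f a = f b -> (a < b)%N -> False.
    move=> fab ab.
    have fb : nth 0 (x :: l) b \in I (f a) by rewrite fab.
    apply: (negP (length_lt_separated (Id (f a)) (fP a) fb)).
    apply: (sorted_ltn_nth (separated_trans d0)) => //.
      by rewrite inE /= ltn_ord.
    by rewrite inE /= ltn_ord.
  by case/orP => h; exfalso; [apply: (key j i)|apply: (key i j)].
have := leq_card f finj; rewrite !card_ord; lia.
Qed.

(* The points are chosen from right to left, each almost at the left end of the
   part of [A] that the greedy cover has not yet used. *)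
Lemma separated_of_uncoverable A delta n : 0 <= delta -> has_lbound A ->
  ~ interval_cover A delta n ->
  exists x l, [/\ path (separated delta) x l, size l = n &
    forall z, z \in x :: l -> A z].
Proof.
move=> d0; elim: n A => [|n IH] A lbA nA.
  have [x Ax] : A !=set0.
    apply/set0P/negP => /eqP A0; apply: nA; exists (fun=> `]0, 0[).
    by split; [case|rewrite A0].
  by exists x, [::]; split => // z; rewrite inE => /eqP->.
have A0 : A !=set0.
  apply/set0P/negP => /eqP A0; apply: nA; exists (fun=> `]0, 0[).
  split; last by rewrite A0.
  by move=> i; rewrite set_itvoo0 measure0 lee_fin.
pose a := inf A.
have infA : has_inf A by [].
pose A' := A `&` [set z | a + delta < z].
have lbA' : has_lbound A'.
  by case: lbA => m lm; exists m => z [Az _]; exact: lm.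
have nA' : ~ interval_cover A' delta n.
  move=> [I [Id A'I]]; apply: nA.
  exists (fun i => if unlift ord0 i is Some j then I j else `[a, a + delta]).
  split=> [i|z Az].
    case: unliftP => [j _|_]; first exact: Id.
    rewrite lebesgue_measure_itv/= lte_fin; case: ifPn => _; last by rewrite lee_fin.
    by rewrite -EFinB lee_fin; lra.
  have [az|az] := ltP (a + delta) z.
    have [j _ Ij] := A'I z (conj Az az).
    by exists (lift ord0 j) => //; rewrite liftK.
  exists ord0 => //; rewrite unlift_none /= in_itv/= az andbT.
  exact: inf_lbound.
have [x [l [xl ln lA]]] := IH _ lbA' nA'.
have [Ax ax] := lA _ (mem_head _ _).
(* The infimum need not be attained; the strict excess of [x] over [a + delta] is the tolerance that
   keeps [p + delta < x]. *)
have [p Ap pa] := inf_adherent (eps := x - (a + delta))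
  ltac:(by rewrite subr_gt0) infA.
exists p, (x :: l); split => //=.
- by rewrite xl andbT; move: pa; rewrite -/a /separated/= => pa; lra.
- by rewrite ln.
- by move=> z; rewrite inE => /predU1P[->//|/lA[]].
Qed.

End separated_points.

Section covering_number.
Context (R : realType).
Implicit Types (A : set R) (delta : R).

Lemma covering_number_le A delta n :
  interval_cover A delta n -> (covering_number A delta <= n%:R%:E)%E.
Proof. by move=> An; apply: ereal_inf_lbound; exists n. Qed.

Lemma covering_number_ge A delta (x : R) :
  (forall n, interval_cover A delta n -> x <= n%:R) ->
  (x%:E <= covering_number A delta)%E.
Proof. by move=> h; apply: le_ereal_inf_tmp => _ [n An <-]; rewrite lee_fin h. Qed.

Lemma covering_number_ge0 A delta : (0 <= covering_number A delta)%E.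
Proof. by apply: covering_number_ge => n _. Qed.

Lemma covering_number_nonincreasing A delta delta' : delta <= delta' ->
  (covering_number A delta' <= covering_number A delta)%E.
Proof.
move=> dd'; apply: ereal_inf_le_tmp => _ [n [I [Id AI]] <-]; exists n => //.
by exists I; split=> // i; apply: le_trans (Id i) _; rewrite lee_fin.
Qed.

End covering_number.

(* The state is the length used in the current block together with the number of
   completed blocks.  The test [0 <= _] fails only for negative increments, and
   keeps the first component in [0, delta] on all paths. *)
Definition block_step (R : realType) (delta : R) (s : R * nat) (x : R) :
    R * nat :=
  if 0 <= s.1 + x <= delta then (s.1 + x, s.2) else (0, s.2.+1).

Lemma measurable_fun_itvcc (R : realType) (d : measure_display)
  (S : measurableType d) (f : S -> R) (a b : R) : measurable_fun setT f ->
  measurable_fun setT (fun z => a <= f z <= b).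
Proof. by move=> mf; apply: measurable_and; exact: measurable_fun_ler. Qed.

Lemma measurable_nat_fun (d : measure_display) (S : measurableType d)
  (f : nat -> S) : measurable_fun setT f.
Proof. by []. Qed.

Lemma measurable_block_step (R : realType) (delta : R) :
  measurable_fun setT (fun p : (R * nat) * R => block_step delta p.1 p.2).
Proof.
have m1 : measurable_fun setT (fun p : (R * nat) * R => p.1.1 + p.2).
  apply: measurable_funD => //.
  by apply: (measurableT_comp measurable_fst); exact: measurable_fst.
have m2 : measurable_fun setT (fun p : (R * nat) * R => p.1.2).
  by apply: (measurableT_comp measurable_snd); exact: measurable_fst.
apply: measurable_fun_ifT; first exact: measurable_fun_itvcc.
  exact: measurable_fun_pair.
apply: measurable_fun_pair; first exact: measurable_cst.
by apply: (measurableT_comp (measurable_nat_fun succn)).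
Qed.

Section greedy_blocks.
Context (disp : measure_display) (T : measurableType disp) (R : realType)
  (xi : nat -> {mfun T >-> R}).

Definition blocks (delta : R) : nat -> T -> R * nat :=
  chain xi (block_step delta) (0, 0%N).

Lemma measurable_blocks delta n : measurable_fun setT (blocks delta n).
Proof. by apply: measurable_chain; exact: measurable_block_step. Qed.

Lemma measurable_block_count delta n :
  measurable_fun setT (fun w => (blocks delta n w).2%:R : R).
Proof.
apply: (measurableT_comp (measurable_nat_fun (fun n => n%:R : R))).
exact: (measurableT_comp measurable_snd (measurable_blocks delta n)).
Qed.

Lemma blocks_range delta n w : 0 <= delta -> 0 <= (blocks delta n w).1 <= delta.
Proof.
move=> d0; elim: n => [|n IH] /=; first by rewrite lexx.
by rewrite /block_step; case: ifP => //= _; rewrite lexx.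
Qed.

Context (delta : R) (w : T) (s : nat -> R).
Hypotheses (delta_ge0 : 0 <= delta) (s_nd : nondecreasing_seq s)
  (xiE : forall n, xi n w = s n.+1 - s n).

Let y n := (blocks delta n w).1.
Let c n := (blocks delta n w).2.

Lemma blocksS n :
  (c n.+1 = c n /\ y n.+1 = y n + (s n.+1 - s n)) \/
  [/\ c n.+1 = (c n).+1, y n.+1 = 0 & delta < y n + (s n.+1 - s n)].
Proof.
have /andP[y0 _] := blocks_range n w delta_ge0.
have s0 := s_nd (leqnSn n).
have -> : c n.+1 = (block_step delta (blocks delta n w) (xi n w)).2 by [].
have -> : y n.+1 = (block_step delta (blocks delta n w) (xi n w)).1 by [].
rewrite xiE /c /y /block_step; case: (blocks delta n w) y0 => a b /= a0.
by rewrite addr_ge0 ?subr_ge0//=; case: leP => h; [left|right].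
Qed.

(** Without a completed block the used length would grow by [s b - s a], beyond its range
    [0, delta]. *)
Lemma blocks_climb a b : (a <= b)%N -> delta < s b - s a -> (c a < c b)%N.
Proof.
move=> ab sab.
have key : (c a < c b)%N \/ (c b = c a /\ y b - y a = s b - s a).
  elim: b ab {sab} => [|b IH]; first by rewrite leqn0 => /eqP->; right; split => //; lra.
  rewrite leq_eqVlt => /predU1P[->|]; first by right; split => //; lra.
  rewrite ltnS => /IH{}IH; case: (blocksS b) => [[-> ->]|[-> _ _]].
    by case: IH => [|[-> h]]; [left|right; split => //; lra].
  by left; case: IH => [|[-> _]]; lia.
case: key => // -[_ h].
have /andP[_ yb] := blocks_range b w delta_ge0.
have /andP[ya _] := blocks_range a w delta_ge0.
by move: h; rewrite /y; lra.
Qed.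

(** The points are the block starts; [s n - y n] is the start of the current block, which carries
    the induction. *)
Lemma blocks_separated n : exists x l,
  [/\ path (separated delta) x l, size l = c n, last x l = s n - y n &
    forall z, z \in x :: l -> exists2 i, (i <= n)%N & z = s i].
Proof.
elim: n => [|n [x [l [xl lc xb xs]]]].
  exists (s 0%N), [::]; split => //=; first by rewrite subr0.
  by move=> z; rewrite inE => /eqP ->; exists 0%N.
case: (blocksS n) => [[cE yE]|[cE yE h]].
  exists x, l; split; rewrite ?cE ?yE//; first by rewrite xb; lra.
  by move=> z /xs[i im ->]; exists i => //; lia.
exists x, (rcons l (s n.+1)); split.
- by rewrite rcons_path xl xb /separated/=; lra.
- by rewrite size_rcons lc cE.
- by rewrite last_rcons yE subr0.
- move=> z; rewrite -rcons_cons mem_rcons inE => /predU1P[->|/xs[i im ->]].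
    by exists n.+1.
  by exists i => //; lia.
Qed.

Lemma blocks_lt_covering_number n (A : set R) :
  (forall i, (i <= n)%N -> A (s i)) ->
  ((c n).+1%:R%:E <= covering_number A delta)%E.
Proof.
move=> sA; have [x [l [xl <- _ lA]]] := blocks_separated n.
apply: covering_number_ge => m Am; rewrite ler_nat.
apply: (interval_cover_separated delta_ge0 Am xl) => z /lA[i im ->].
exact: sA.
Qed.

(** Optimality of the greedy choice: between two consecutive separated points the path climbs more
    than [delta], so by [blocks_climb] a block is completed. *)
Lemma separated_le_blocks n x l : path (separated delta) x l ->
  (forall z, z \in x :: l -> exists2 i, (i <= n)%N & z = s i) ->
  (size l <= c n)%N.
Proof.
move=> xl lA.
have cmono i : (i <= n)%N -> (c i <= c n)%N.
  elim: {lA}n => [|m IH]; first by rewrite leqn0 => /eqP ->.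
  rewrite leq_eqVlt => /predU1P[->//|]; rewrite ltnS => /IH ic.
  by case: (blocksS m) => [[-> _]|[-> _ _]] //; lia.
suff : forall i, (i <= n)%N -> s i = last x l -> (size l <= c i)%N.
  move=> h; have [i im si] := lA _ (mem_last x l).
  by apply: leq_trans (cmono _ im); apply: h.
elim/last_ind: l xl lA => [//|l z IH].
rewrite rcons_path => /andP[xl sep] lA i im; rewrite last_rcons size_rcons => si.
have [j jm sj] : exists2 j, (j <= n)%N & last x l = s j.
  by apply: lA; rewrite -rcons_cons mem_rcons inE mem_last orbT.
have lj : (size l <= c j)%N.
  apply: IH => // u ul; apply: lA.
  by rewrite -rcons_cons mem_rcons inE ul orbT.
move: sep; rewrite /separated/= -si sj => sep.
have ij : (j <= i)%N.
  rewrite leqNgt; apply/negP => ij.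
  have sij : s i <= s j by apply: s_nd; exact: ltnW.
  have := delta_ge0; lra.
by apply: leq_ltn_trans lj _; apply: blocks_climb => //; lra.
Qed.

End greedy_blocks.

(** * Concentration of the number of blocks *)

Section discrete_renewal.
Context (disp : measure_display) (T : measurableType disp) (R : realType)
  (P : probability T R).
Variable xi : nat -> {mfun T >-> R}.
Hypothesis xi_indep : forall n, independent_RVs P (fun i : 'I_n => xi i).
Hypothesis xi_id : forall i (B : set R), measurable B ->
  P (xi i @^-1` B) = P (xi 0%N @^-1` B).
Hypothesis xi_ge0 : P (xi 0%N @^-1` `]-oo, 0[) = 0%E.
Local Open Scope ereal_scope.

Let nu := distribution P (xi 0%N).

Definition walk := chain xi (fun s x : R => s + x)%R 0%R.

Let mwalk n : measurable_fun setT (walk n).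
Proof. by apply: measurable_chain; exact: measurable_funD. Qed.

Let measurable_walk_le n a : measurable [set w | (walk n w <= a)%R].
Proof.
have := mwalk n measurableT (measurable_itv `]-oo, a]).
by rewrite setTI.
Qed.

Let walk_le n a := P [set w | (walk n w <= a)%R].

Let distribution_xi i (f : R -> \bar R) :
  \int[distribution P (xi i)]_x f x = \int[nu]_x f x.
Proof. by apply: eq_measure_integral => A mA _; exact: xi_id. Qed.

Let ae_nu_ge0 : {ae nu, forall x, (0 <= x)%R}.
Proof.
exists `]-oo, 0%R[%classic; split => //= x /= /negP.
by rewrite -ltNge in_itv.
Qed.

Let walk_le_mono n : {homo walk_le n : a b / (a <= b)%R >-> a <= b}.
Proof.
by move=> a b ab; apply: le_measure; rewrite ?inE// => w /= /le_trans; apply.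
Qed.

Let walk_le_fin n a : walk_le n a \is a fin_num.
Proof. exact: fin_num_measure. Qed.

Let measurable_walk_leB n a :
  measurable_fun setT (fun x : R => walk_le n (a - x)%R).
Proof.
rewrite (_ : (fun _ => _) = EFin \o (fun x : R => fine (walk_le n (a - x)%R))); last first.
  by apply/funext => x /=; rewrite fineK.
apply/measurable_EFinP; apply: nonincreasing_measurable => // x y xy.
by apply: fine_le => //; apply: walk_le_mono; lra.
Qed.

(** Conditioning is on the last step, which [chain_indep] makes independent of [walk n];
    equidistribution then replaces its law by [nu]. *)
Let walk_leS n a : walk_le n.+1 a = \int[nu]_x walk_le n (a - x)%R.
Proof.
have ind : independent_pair P (xi n) (walk n).
  move=> A B mA mB; rewrite setIC muleC; apply: chain_indep => //.
  exact: measurable_funD.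
pose W : {mfun T >-> R} := mfun_Sub (mem_set (mwalk n)).
pose D := [set z : R * R | (z.2 + z.1 <= a)%R].
have mD : measurable D.
  rewrite -[D]setTI; apply: measurable_fun_le => //.
  exact: measurable_funD.
pose f (z : R * R) : \bar R := (\1_D z)%:E.
have mf : measurable_fun setT f by exact/measurable_EFinP/measurable_indic.
have f0 z : 0 <= f z by rewrite lee_fin.
have := @integral_independent_pair _ _ _ P _ _ _ _ (xi n) W f ind mf f0.
have mDn : measurable [set w | D (xi n w, W w)] by exact: measurable_walk_le n.+1 a.
rewrite (_ : \int[P]_w f (xi n w, W w) = walk_le n.+1 a); last first.
  rewrite [RHS]/walk_le -[X in _ = P X]setIT -integral_indic//.
move=> ->.
rewrite -(distribution_xi n) ge0_integral_distribution//.
apply: eq_integral => w _ /=.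
have mDw : measurable [set x | (x <= a - xi n w)%R].
  by rewrite (_ : [set _ | _] = `]-oo, (a - xi n w)%R]%classic)//;
    apply/seteqP; split => x /=; rewrite in_itv.
rewrite (_ : (fun x => f (xi n w, x)) =
    (fun x => (\1_[set x | (x <= a - xi n w)%R] x)%:E)); last first.
  apply/funext => x; rewrite /f !indicE; congr ((nat_of_bool _)%:R%:E).
  by apply/idP/idP; rewrite !inE /D/= => h; lra.
by rewrite integral_indic// setIT.
Qed.

Let walk_le_lt0 n a : (a < 0)%R -> walk_le n a = 0.
Proof.
elim: n a => [|n IH] a a0.
  rewrite /walk_le (_ : [set _ | _] = set0) ?measure0//.
  by apply/seteqP; split => // w /=; rewrite leNgt a0.
rewrite walk_leS (ge0_ae_eq_integral (g := cst 0))// ?integral0//.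
case: ae_nu_ge0 => N [mN N0 h]; exists N; split => // x /= nx; apply: h => /= x0.
by apply: nx => _; apply: IH; lra.
Qed.

(** The renewal function of the walk. When the steps are increments of X over a time [h], [h] times
    it approximates U(a). *)
Definition walk_mass (a : R) := \sum_(n <oo) P [set w | (walk n w <= a)%R].
Let potl := walk_mass.
Hypothesis potl_fin : forall a, potl a < +oo.

Let potl_mono : {homo potl : a b / (a <= b)%R >-> a <= b}.
Proof. by move=> a b ab; apply: lee_nneseries => // n _; exact: walk_le_mono. Qed.

Let potl_ge0 a : 0 <= potl a.
Proof. exact: nneseries_ge0. Qed.

Let potl_fin_num a : potl a \is a fin_num.
Proof. by rewrite ge0_fin_numE. Qed.

Let potl_lt0 a : (a < 0)%R -> potl a = 0.
Proof. by move=> a0; apply: eseries0 => n _ _; exact: walk_le_lt0. Qed.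

(** The renewal equation: the term [n = 0] gives 1, and [walk_leS] shifts the others. *)
Let potl_rec a : (0 <= a)%R -> potl a = 1 + \int[nu]_x potl (a - x)%R.
Proof.
move=> a0; rewrite /potl /walk_mass nneseries_recl//; congr +%E.
  rewrite /walk_le (_ : [set _ | _] = setT) ?probability_setT//.
  by apply/seteqP; split.
rewrite -nneseries_addn// integral_nneseries//; last first.
  by move=> n; exact: measurable_walk_leB.
by apply: eq_eseriesr => n _; rewrite addn1; exact: walk_leS.
Qed.

Variable delta : R.
Hypothesis delta_ge0 : (0 <= delta)%R.

Let mu := fine (potl delta).
(** The mean number of steps left in a block of which [y] is used, counting the step that closes it:
    with nonnegative steps these are the [n] with [y + walk n <= delta]. *)
Let V (y : R) : R := fine (potl (delta - y)%R).
(** The cut-off uses the test of [block_step], so [V'] vanishes exactly when a step closes the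
    block. *)
Let V' (z : R) : R := if (0 <= z <= delta)%R then V z else 0%R.

Let V0 : V 0%R = mu.
Proof. by rewrite /V subr0. Qed.

Let V_ge0 y : (0 <= V y)%R.
Proof. by apply: fine_ge0; exact: potl_ge0. Qed.

Let V_le y : (0 <= y)%R -> (V y <= mu)%R.
Proof. by move=> y0; apply: fine_le => //; apply: potl_mono; lra. Qed.

Let measurable_V : measurable_fun setT V.
Proof.
apply: nonincreasing_measurable => // x y xy.
by apply: fine_le => //; apply: potl_mono; lra.
Qed.

Let measurable_V' : measurable_fun setT V'.
Proof. by apply: measurable_fun_ifT => //; exact: measurable_fun_itvcc. Qed.

Let V'_ge0 z : (0 <= V' z)%R.
Proof. by rewrite /V'; case: ifP. Qed.

(** The martingale property: by the renewal equation one step lowers the mean time left by one. *)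
Let integral_V' y : (0 <= y <= delta)%R ->
  \int[nu]_x (V' (y + x)%R)%:E = (V y - 1)%:E.
Proof.
move=> /andP[y0 yd]; rewrite EFinB /V fineK//.
rewrite (potl_rec (a := (delta - y)%R)) ?subr_ge0// [X in _ = X - _]addeC addeK//.
apply: ge0_ae_eq_integral => //.
- by apply/measurable_EFinP; apply: measurableT_comp => //; exact: measurable_funD.
- rewrite (_ : (fun _ => _) =
    EFin \o (fun x : R => fine (potl (delta - y - x)%R))); last first.
    by apply/funext => x /=; rewrite fineK.
  apply/measurable_EFinP; apply: nonincreasing_measurable => // x z xz.
  by apply: fine_le => //; apply: potl_mono; lra.
- by move=> x _; rewrite lee_fin.
case: ae_nu_ge0 => N [mN N0 h]; exists N; split => // x /= nx; apply: h => /= x0.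
apply: nx => _; rewrite /V'; case: ifPn => [_|].
  by rewrite /V fineK//; congr potl; lra.
rewrite negb_and -!ltNge => h; rewrite potl_lt0//.
by case/orP: h => ?; lra.
Qed.

Let step := block_step delta.

Let state := blocks xi delta.

Let mstate n : measurable_fun setT (state n).
Proof. exact: measurable_blocks. Qed.

Let state_range n w : (0 <= (state n w).1 <= delta)%R.
Proof. exact: blocks_range. Qed.

(* The square of the centred martingale, corrected so that [H j.+1] after one
   step is affine in [V'], whose mean [integral_V'] gives. *)
Let H (j : nat) (s : R * nat) : R :=
  ((V s.1 - mu * s.2%:R + j%:R - mu) ^+ 2 +
    mu ^+ 2 * s.2%:R + mu ^+ 2 - V s.1 ^+ 2)%R.

Let measurable_H j : measurable_fun setT (H j).
Proof.
have m1 : measurable_fun setT (fun s : R * nat => V s.1).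
  exact: measurableT_comp.
have m2 : measurable_fun setT (fun s : R * nat => s.2%:R : R).
  exact: (measurableT_comp (measurable_nat_fun (fun n => n%:R : R))).
rewrite /H; apply: measurable_funB; last exact: measurable_funX.
apply: measurable_funD => //; apply: measurable_funD.
  apply: measurable_funX; apply: measurable_funB => //.
  apply: measurable_funD => //; apply: measurable_funB => //.
  exact: measurable_funM.
exact: measurable_funM.
Qed.

Let H_ge j (s : R * nat) : (0 <= s.1)%R ->
  ((V s.1 - mu * s.2%:R + j%:R - mu) ^+ 2 <= H j s)%R.
Proof.
move=> s0; rewrite /H.
have : (V s.1 ^+ 2 <= mu ^+ 2)%R.
  by rewrite ler_pXn2r ?nnegrE// ?V_le// -V0.
have : (0 <= mu ^+ 2 * s.2%:R)%R by rewrite mulr_ge0// sqr_ge0.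
lra.
Qed.

(** Closing a block resets [V] to [mu] and raises [mu * s.2] by [mu]; these cancel, so both cases
    share one formula. Subtracting the square of [V] removes the quadratic term in [V'], and
    [mu ^+ 2 * s.2] balances that subtraction at a reset. *)
Let H_step j (s : R * nat) x : (0 <= s.1 <= delta)%R ->
  (H j.+1 (step s x) =
   (1 - mu * s.2%:R + j%:R - mu) ^+ 2 + mu ^+ 2 * s.2%:R + mu ^+ 2 +
   2 * (1 - mu * s.2%:R + j%:R - mu) * V' (s.1 + x))%R.
Proof.
move=> s1; rewrite /H /step /block_step /V' -[j.+1%:R]natr1; case: ifP => _ /=; first ring.
by rewrite V0 -[s.2.+1%:R]natr1; ring.
Qed.

Let integral_H_step j (s : R * nat) : (0 <= s.1 <= delta)%R ->
  \int[nu]_x (H j.+1 (step s x))%:E <= (H j s + 2 * mu)%:E.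
Proof.
move=> s1.
have iV' : nu.-integrable setT (fun x : R => (V' (s.1 + x)%R)%:E).
  apply/integrableP; split.
    by apply/measurable_EFinP; apply: measurableT_comp => //; exact: measurable_funD.
  under eq_integral do rewrite gee0_abs ?lee_fin//.
  by rewrite integral_V'// ltry.
set a := ((1 - mu * s.2%:R + j%:R - mu) ^+ 2 + mu ^+ 2 * s.2%:R + mu ^+ 2)%R.
set b := (2 * (1 - mu * s.2%:R + j%:R - mu))%R.
under eq_integral do rewrite H_step// -/a -/b EFinD EFinM.
rewrite integralD//; last 2 first.
- exact: finite_measure_integrable_cst.
- exact: integrableZl.
rewrite integralZl// integral_V'// integral_cst//= probability_setT mule1.
rewrite -EFinM -EFinD lee_fin /a /b /H.
(* The increase of the mean is exactly [2 * V s.1 - 1]. *)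
have := V_le (y := s.1); move: (s1) => /andP[-> _] /(_ isT).
set v := V _; set c := s.2%:R; move=> vmu.
nra.
Qed.

Let expectation_H n : \int[P]_w (H n (state n w))%:E <= (2 * n%:R * mu)%:E.
Proof.
elim: n => [|n IH].
  rewrite /= /H/= V0 (_ : (_ - _)%R = 0%R); last by ring.
  by rewrite integral0 mulr0 mul0r.
pose X : {mfun T >-> (R * nat)%type} := mfun_Sub (mem_set (mstate n)).
have ind : independent_pair P X (xi n) by apply: chain_indep => //; exact: measurable_block_step.
pose f (z : (R * nat) * R) : \bar R := (H n.+1 (step z.1 z.2))%:E.
have mf : measurable_fun setT f.
  apply/measurable_EFinP; apply: measurableT_comp => //.
  exact: measurable_block_step.
have f0 z : 0 <= f z.
  rewrite lee_fin; apply: le_trans (H_ge _ _); first exact: sqr_ge0.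
  by rewrite /step /block_step; case: ifP => //= /andP[].
have mH k : measurable_fun setT (fun w => (H k (state k w))%:E).
  by apply/measurable_EFinP; exact: measurableT_comp.
have Hn0 w : 0 <= (H n (state n w))%:E.
  rewrite lee_fin; apply: le_trans (H_ge _ _); first exact: sqr_ge0.
  by have /andP[] := state_range n w.
have mu0 : (0 <= mu)%R by rewrite -V0.
have mu20 : (0 <= 2 * mu)%R by rewrite mulr_ge0.
have := integral_independent_pair ind mf f0; rewrite /f/= => ->.
apply: (@le_trans _ _ (\int[P]_w ((H n (state n w))%:E + (2 * mu)%:E))).
  apply: ge0_le_integral => //.
  - by move=> w _; apply: integral_ge0 => x _; exact: (f0 (state n w, x)).
  - exact: (measurableT_comp
      (measurable_fun_fubini_tonelli_F (m2 := distribution P (xi n)) f mf f0)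
      (mstate n)).
  - by apply: emeasurable_funD => //; exact: mH.
  - by move=> w _; rewrite distribution_xi; apply: integral_H_step.
rewrite ge0_integralD//=.
rewrite integral_cst//= probability_setT mule1 -[n.+1%:R]natr1.
rewrite mulrDr mulr1 mulrDl EFinD; exact: leeD.
Qed.

(** Markov's inequality for [H n] at level [a ^+ 2]. The threshold carries an extra mean block
    length because dropping [V - mu], which lies in [-mu, 0], costs at most [mu]. *)
Lemma renewal_count_concentration n (a : R) : (0 < a)%R ->
  P [set w | (a + fine (walk_mass delta) <=
    `|fine (walk_mass delta) * (blocks xi delta n w).2%:R - n%:R|)%R] <=
  (2 * n%:R * fine (walk_mass delta) / a ^+ 2)%:E.
Proof.
rewrite -/mu -/state => a0.
have a20 : (0 < a ^+ 2)%R by rewrite exprn_gt0.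
rewrite EFinM muleC -lee_pdivrMl; last by rewrite invr_gt0.
rewrite invrK; apply: le_trans (expectation_H n).
have mHn : measurable_fun setT (fun w => (H n (state n w))%:E).
  by apply/measurable_EFinP; exact: measurableT_comp.
have H0 w : (0 <= H n (state n w))%R.
  apply: le_trans (H_ge _ _); first exact: sqr_ge0.
  by have /andP[] := state_range n w.
have := @le_integral_comp_abse _ T R P setT measurableT
  (fun w => (H n (state n w))%:E) (a ^+ 2)%R idfun (@measurable_id _ _ _)
  (fun _ r0 => r0) (fun _ _ _ _ xy => xy) mHn a20.
under eq_integral do rewrite gee0_abs ?lee_fin//=.
rewrite setTI; apply: le_trans; rewrite /= lee_pmul2l ?lte_fin//.
apply: le_measure; rewrite ?inE.
- rewrite -[[set _ | _]]setTI; apply: measurable_fun_le => //.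
  apply: measurableT_comp => //; apply: measurable_funB => //.
  by apply: measurable_funM => //; exact: measurable_block_count.
- rewrite -[[set _ | _]]setTI; apply: measurable_lee => //.
  apply/measurable_EFinP; apply: measurableT_comp => //.
  exact/measurable_EFinP.
move=> w /= aw; rewrite lee_fin ger0_norm//.
have /andP[s0 _] := state_range n w.
apply: le_trans (H_ge n s0); rewrite -[leRHS]real_normK ?num_real//.
rewrite ler_pXn2r ?nnegrE ?(ltW a0)//.
have := V_le s0; have := V_ge0 (state n w).1.
move: aw; set v := V _; set c := (mu * _)%R => aw v0 vmu.
have : (`|c - n%:R| <= `|v - c + n%:R - mu| + `|v - mu|)%R.
  rewrite (_ : c - n%:R = (v - mu) - (v - c + n%:R - mu))%R; last by ring.
  by rewrite (le_trans (ler_normB _ _))// addrC.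
rewrite (ler0_norm (x := (v - mu)%R)) ?subr_le0//.
lra.
Qed.

End discrete_renewal.

(** * The potential function *)

Section subordinator_potential.
Context (disp : measure_display) (T : measurableType disp) (R : realType)
  (P : probability T R) (X : R -> {RV P >-> R}).
Hypothesis hX : levy_process X.
Hypothesis X_nd :
  {ae P, forall w, forall s t : R, 0 <= s -> s <= t -> X s w <= X t w}.

Definition increment (h : R) (n : nat) : {mfun T >-> R} :=
  X (n.+1%:R * h) \- X (n%:R * h).

(** Named after first passage: on a nondecreasing path the event says that level [a] has not been
    exceeded by time [t]. *)
Definition survival (a t : R) : \bar R := P [set w | X t w <= a].

Lemma measurable_survival a t : measurable [set w | X t w <= a].
Proof.
have mX : measurable_fun setT (X t) by [].
by have := mX measurableT _ (measurable_itv `]-oo, a]); rewrite setTI.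
Qed.
#[local] Hint Resolve measurable_survival : core.

Lemma survival_ge0 a t : (0 <= survival a t)%E.
Proof. exact: measure_ge0. Qed.

Lemma survival_fin_num a t : survival a t \is a fin_num.
Proof. exact: fin_num_measure. Qed.

Lemma survival_le1 a t : (survival a t <= 1)%E.
Proof. exact: probability_le1. Qed.

Lemma survival_homo t : {homo survival^~ t : a b / a <= b >-> (a <= b)%E}.
Proof.
by move=> a b ab; apply: le_measure; rewrite ?inE// => w /= /le_trans; apply.
Qed.

Lemma measure_le_ae (A B : set T) : measurable A -> measurable B ->
  {ae P, forall w, A w -> B w} -> (P A <= P B)%E.
Proof.
move=> mA mB [N [mN N0 h]].
apply: (@le_trans _ _ (P (B `|` N))).
  apply: le_measure; rewrite ?inE//; first exact: measurableU.
  move=> w Aw; have [Bw|Bw] := pselect (B w); [by left|right].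
  by apply: h => /(_ Aw).
by apply: le_trans (measureU2 _ _ _) _; rewrite //= [X in (_ + X)%E]N0 adde0.
Qed.

Lemma survival_nonincreasing a s t : 0 <= s -> s <= t ->
  (survival a t <= survival a s)%E.
Proof.
move=> s0 st; apply: measure_le_ae => //.
by case: X_nd => N [mN N0 h]; exists N; split => // w /= nw; apply: h => /= hw;
  apply: nw => /(le_trans (hw _ _ s0 st)).
Qed.

Lemma increment_indep h : 0 < h ->
  forall n, independent_RVs P (fun i : 'I_n => increment h i).
Proof.
move=> h0 n; have := levy_independent_increments hX (n := n)
  (s := fun i => i%:R * h).
apply; first by rewrite mul0r.
by apply/increasing_seqP => i; rewrite ltr_pM2r// ltr_nat.
Qed.

Lemma prob_increment h (n : nat) B : 0 < h -> measurable B ->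
  P (increment h n @^-1` B) = P (X h @^-1` B).
Proof.
move=> h0 mB; rewrite -(levy_stationary_increments hX (s := n%:R * h)) ?mulr_ge0// ?ltW//.
by rewrite /increment -natr1 mulrDl mul1r.
Qed.

Lemma increment_id h i B : 0 < h -> measurable B ->
  P (increment h i @^-1` B) = P (increment h 0 @^-1` B).
Proof. by move=> h0 mB; rewrite !prob_increment. Qed.

Lemma increment_ge0 h : 0 < h -> P (increment h 0 @^-1` `]-oo, 0[) = 0%E.
Proof.
move=> h0; apply/eqP; rewrite eq_le measure_ge0 andbT -(measure0 P).
apply: measure_le_ae => //.
  by rewrite -[_ @^-1` _]setTI; exact: measurable_funP.
case: X_nd => N [mN N0 hN]; exists N; split => // w /= nw; apply: hN => /= hw.
apply: nw; rewrite in_itv/= mul0r mul1r subr_lt0 => hlt.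
by have := hw 0 h (lexx _) (ltW h0); rewrite leNgt hlt.
Qed.

Lemma walk_increment h n w : walk (increment h) n w = X (n%:R * h) w - X 0 w.
Proof.
elim: n => [|n IH]; first by rewrite mul0r subrr.
by rewrite [LHS]/= -/(walk _ _) IH /=; ring.
Qed.

(** The walk telescopes to [X (n%:R * h) - X 0], and stationarity from time 0 gives this difference
    the law of [X (n%:R * h)]. *)
Lemma prob_walk_le h n a : 0 < h ->
  P [set w | walk (increment h) n w <= a] = survival a (n%:R * h).
Proof.
move=> h0; have nh : 0 <= n%:R * h by rewrite mulr_ge0// ltW.
have := levy_stationary_increments hX (lexx 0) nh (measurable_itv `]-oo, a]).
rewrite add0r => e; rewrite /survival.
transitivity (P ((X (n%:R * h) \- X 0) @^-1` `]-oo, a]%classic)); last by rewrite e.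
congr (P _); apply/seteqP.
by split=> w /=; rewrite in_itv/= walk_increment.
Qed.

Lemma walk_mass_survival h a : 0 < h ->
  walk_mass P (increment h) a = (\sum_(n <oo) survival a (n%:R * h))%E.
Proof. by move=> h0; apply: eq_eseriesr => n _; exact: prob_walk_le. Qed.

Lemma measurable_survival_time (a : R) :
  measurable_fun (`[0, +oo[%classic : set R) (survival a).
Proof.
(* Monotonicity is known for nonnegative times only; the maximum extends it to the whole line. *)
pose g t := fine (survival a (Num.max 0 t)).
apply: (@eq_measurable_fun _ _ _ _ _ (EFin \o g)).
  move=> t; rewrite inE/= in_itv/= andbT => t0.
  by rewrite /g /= fineK ?survival_fin_num// max_r.
apply/measurable_EFinP; apply: nonincreasing_measurable => // s t st.
apply: fine_le; rewrite ?survival_fin_num//.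
apply: survival_nonincreasing; first by rewrite le_max lexx.
by rewrite ge_max !le_max lexx st orbT.
Qed.

Lemma itv_bigcup (h : R) : 0 < h ->
  `[0, +oo[%classic = \bigcup_k `[k%:R * h, k.+1%:R * h[%classic.
Proof.
move=> h0; apply/seteqP; split=> [x /=|x [k _] /=]; rewrite !in_itv/= andbT.
  move=> x0; exists (Num.truncn (x / h)) => //=; rewrite in_itv/=.
  have := truncn_itv (divr_ge0 x0 (ltW h0)).
  by rewrite ler_pdivlMr// ltr_pdivrMr.
by case/andP => + _; apply: le_trans; rewrite mulr_ge0// ltW.
Qed.

(** Riemann sums of the nonincreasing [survival a]: the upper and lower sums of mesh [h] differ by
    their first term, at most [h]. *)
Lemma potential_walk_mass (h a : R) : 0 < h ->
  (potential X a <= h%:E * walk_mass P (increment h) a /\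
   h%:E * walk_mass P (increment h) a <= h%:E + potential X a)%E.
Proof.
move=> h0; rewrite walk_mass_survival//.
pose F k := `[k%:R * h, k.+1%:R * h[%classic.
have Fh k : lebesgue_measure (F k : set R) = h%:E.
  rewrite lebesgue_measure_itv/= lte_fin ltr_pM2r// ltr_nat ltnSn.
  by rewrite -EFinB -mulrBl -natrB// subSnn mul1r.
have mF k : measurable (F k : set R) by exact: measurable_itv.
have ic k (r : \bar R) :
    (\int[lebesgue_measure]_(t in F k) cst r t = r * h%:E)%E.
  by rewrite integral_cst; [congr (_ * _)%E; exact: Fh|exact: mF].
have sub k : F k `<=` `[0, +oo[%classic.
  by rewrite (itv_bigcup h0); exact: bigcup_sup.
have mS k : measurable_fun (F k) (survival a).
  by apply: measurable_funS (measurable_survival_time a) => //; exact: sub.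
have UE : potential X a =
    (\sum_(k <oo) \int[lebesgue_measure]_(t in F k) survival a t)%E.
  rewrite /potential (itv_bigcup h0) ge0_integral_bigcup//.
  - by rewrite -(itv_bigcup h0); exact: measurable_survival_time.
  - apply/trivIsetP => i j _ _ ij; apply/eqP/negPn/negP => /set0P[x [/=]].
    rewrite !in_itv/= => /andP[ix xi] /andP[jx xj]; move: ij.
    have := le_lt_trans ix xj; have := le_lt_trans jx xi.
    by rewrite !ltr_pM2r// !ltr_nat; lia.
have up k : (\int[lebesgue_measure]_(t in F k) survival a t <=
    h%:E * survival a (k%:R * h))%E.
  rewrite muleC -(ic k).
  apply: ge0_le_integral;
    [exact: mF|by []|exact: mS|exact: measurable_cst|move=> t].
  rewrite /F/= in_itv/= => /andP[kt _].
  by apply: survival_nonincreasing => //; rewrite mulr_ge0// ltW.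
have lo k : (h%:E * survival a (k.+1%:R * h) <=
    \int[lebesgue_measure]_(t in F k) survival a t)%E.
  rewrite muleC -(ic k).
  apply: ge0_le_integral;
    [exact: mF|by []|exact: measurable_cst|exact: mS|move=> t].
  move=> /[dup] /sub /=; rewrite /F/= !in_itv/= andbT => t0.
  by move=> /andP[_ /ltW]; exact: survival_nonincreasing.
rewrite UE -nneseriesZl//; split.
  apply: lee_nneseries => // k _ _.
  by apply: integral_ge0 => x _; exact: survival_ge0.
rewrite nneseries_recl//; last first.
  by move=> k _; rewrite mule_ge0 ?survival_ge0 ?lee_fin ?(ltW h0).
rewrite leeD//.
  by rewrite -[leRHS]mule1 lee_pmul2l ?lte_fin// survival_le1.
rewrite -nneseries_addn; last by move=> k; rewrite mule_ge0 ?survival_ge0 ?lee_fin ?(ltW h0).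
apply: lee_nneseries => k; first by rewrite mule_ge0 ?survival_ge0 ?lee_fin ?(ltW h0).
by rewrite addn1.
Qed.

(* A walk below [a + b] at time [n.+1] was below [a] at time [n], or was below
   [a + b] and then made a step of at most [b]. *)
Lemma walk_mass_step (h a b : R) : 0 < h ->
  (walk_mass P (increment h) (a + b) <=
    1 + walk_mass P (increment h) a +
    walk_mass P (increment h) (a + b) * survival b h)%E.
Proof.
move=> h0.
have step n : (survival (a + b) (n.+1%:R * h) <= survival a (n%:R * h) +
    survival (a + b) (n%:R * h) * survival b h)%E.
  rewrite -!(prob_walk_le _ _ h0).
  have -> : survival b h = P (increment h n @^-1` `]-oo, b]%classic).
    rewrite prob_increment//; congr (P _).
  have mw c : measurable [set w | walk (increment h) n w <= c].
    have mwalk : measurable_fun setT (walk (increment h) n).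
      by apply: measurable_chain; exact: measurable_funD.
    by have := mwalk measurableT _ (measurable_itv `]-oo, c]); rewrite setTI.
  have mi : measurable (increment h n @^-1` `]-oo, b]%classic).
    exact: measurable_funPTI.
  have -> : (P [set w | (walk (increment h) n w <= a + b)%R] *
      P (increment h n @^-1` `]-oo, b]%classic) =
      P ([set w | (walk (increment h) n w <= a + b)%R] `&`
         increment h n @^-1` `]-oo, b]%classic))%E.
    have madd : measurable_fun setT (fun p : R * R => p.1 + p.2).
      exact: measurable_funD.
    have := chain_indep (increment_indep h0) (0 : R) madd n.
    move=> /(_ _ _ (measurable_itv `]-oo, (a + b)%R]) (measurable_itv `]-oo, b])).
    by move/esym.
  apply: le_trans _ (measureU2 P (mw a) (measurableI _ _ (mw (a + b)) mi)).
  apply: measure_le_ae; [|by apply: measurableU => //; exact: measurableI|].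
    have mwalk : measurable_fun setT (walk (increment h) n.+1).
      by apply: measurable_chain; exact: measurable_funD.
    by have := mwalk measurableT _ (measurable_itv `]-oo, (a + b)%R]);
      rewrite setTI.
  case: X_nd => N [mN N0 hN]; exists N; split => // w /= nw; apply: hN => /= hw.
  apply: nw; rewrite in_itv/= => le_ab.
  have x0 : 0 <= increment h n w.
    rewrite subr_ge0; apply: hw; first by rewrite mulr_ge0// ltW.
    by rewrite ler_pM2r// ler_nat.
  have e : walk (increment h) n w + increment h n w <= a + b by [].
  by have [|wa] := leP (walk (increment h) n w) a; [left|right; split; lra].
rewrite !walk_mass_survival// muleC -(fineK (survival_fin_num b h)).
rewrite -nneseriesZl; last by move=> k _.
rewrite [leLHS]nneseries_recl// -addeA leeD ?survival_le1//.
rewrite -nneseriesD//; last first.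
  by move=> k _; rewrite mule_ge0// lee_fin fine_ge0// survival_ge0.
rewrite -nneseries_addn//; apply: lee_nneseries => // k _.
by rewrite addn1 fineK ?survival_fin_num// muleC.
Qed.

End subordinator_potential.

(** * Exponential decay of P(X_t <= a) at arbitrary rates *)

Section laplace_bound.
Context (disp : measure_display) (T : measurableType disp) (R : realType)
  (P : probability T R) (X : R -> {RV P >-> R}) (d : R)
  (Pi : {measure set (measurableTypeR R) -> \bar R}).
Hypothesis hX : subordinator X d Pi.
Hypothesis hPi : Pi `]0, +oo[%classic = +oo%E \/
  ((Pi `]0%R, +oo[%classic < +oo)%E /\ 0 < d).

Lemma laplace_integrand_ge0 (lambda y : R) : 0 < lambda -> 0 < y ->
  0 <= 1 - expR (- (lambda * y)).
Proof. by move=> l0 y0; rewrite subr_ge0 -expR0 ler_expR oppr_le0 mulr_ge0// ltW. Qed.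

Lemma expRN1_le : expR (-1 : R) <= 2^-1.
Proof. by rewrite expRN lef_pV2 ?posrE ?expR_gt0//; have := expR_ge1Dx (1 : R); lra. Qed.

Lemma measurable_laplace_integrand (lambda : R) (D : set (measurableTypeR R)) :
  measurable_fun D (fun y : R => (1 - expR (- (lambda * y)))%:E).
Proof.
apply/measurable_EFinP; apply: measurable_funB => //.
by apply: measurableT_comp => //; apply: measurableT_comp.
Qed.

(** A positive drift gives linear growth. Otherwise the integrand is at least 1/2 for
    [y >= lambda^-1], and the mass that [Pi] gives to that half-line tends to infinity with
    [lambda]. *)
Lemma laplace_exponent_unbounded (M : R) :
  exists2 lambda : R, 0 < lambda & (M%:E <= laplace_exponent d Pi lambda)%E.
Proof.
have d0 := subordinator_drift_ge0 hX.
case: hPi => [Pioo|[_ d_gt0]]; last first.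
  exists (`|M| / d + 1).
    by rewrite ltr_wpDl// divr_ge0// ltW.
  rewrite /laplace_exponent -[leLHS]adde0 leeD//.
    rewrite lee_fin mulrDr mulrCA divff ?gt_eqF// mulr1 mulr1.
    by have := ler_norm M; lra.
  apply: integral_ge0 => y /=; rewrite in_itv/= andbT => y0.
  rewrite lee_fin laplace_integrand_ge0//.
  by rewrite ltr_wpDl// divr_ge0// ltW.
pose F (n : nat) : set (measurableTypeR R) := `[n.+1%:R^-1, +oo[%classic.
have mF n : measurable (F n) by exact: measurable_itv.
have UF : \bigcup_n F n = `]0, +oo[%classic.
  apply/seteqP; split=> [x [n _]|x].
    rewrite /F/= !in_itv/= !andbT; apply: lt_le_trans.
    by rewrite invr_gt0.
  rewrite /= in_itv/= andbT => x0; exists (Num.truncn x^-1) => //.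
  rewrite /F/= in_itv/= andbT invf_ple ?posrE//.
  by apply: ltW; rewrite truncnS_gt.
have ndF : nondecreasing_seq F.
  move=> m n mn; apply/subsetPset => x; rewrite /F/= !in_itv/= !andbT.
  by apply: le_trans; rewrite lef_pV2 ?posrE// ler_nat ltnS.
have := nondecreasing_cvg_mu (mu := Pi) mF (bigcupT_measurable _ mF) ndF.
rewrite UF Pioo => /cvgeyPge /(_ (2 * M)) [n _ /(_ n (leqnn n)) /= Pin].
have l0 : (0 : R) < n.+1%:R by [].
exists n.+1%:R => //.
rewrite /laplace_exponent -[leLHS]add0e leeD//.
  by rewrite lee_fin mulr_ge0.
apply: (@le_trans _ _ (\int[Pi]_(y in F n) cst (2^-1)%:E y)%E).
  rewrite integral_cst//.
  rewrite (_ : M = 2^-1 * (2 * M)); last by field.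
  by rewrite EFinM lee_pmul2l// lte_fin.
apply: (@le_trans _ _
    (\int[Pi]_(y in F n) (1 - expR (- (n.+1%:R * y)))%:E)%E).
  apply: ge0_le_integral.
  - exact: mF.
  - by move=> y _; rewrite lee_fin.
  - exact: measurable_cst.
  - exact: measurable_laplace_integrand.
  move=> y; rewrite /F/= in_itv/= andbT lee_fin => ny.
  have : expR (- (n.+1%:R * y)) <= expR (-1).
    by rewrite ler_expR lerN2 -ler_pdivrMl// mulr1.
  have := expRN1_le; lra.
apply: ge0_subset_integral => //.
- exact: measurable_laplace_integrand.
- move=> y /=; rewrite in_itv/= andbT => y0.
  by rewrite lee_fin laplace_integrand_ge0.
- by rewrite -UF; exact: bigcup_sup.
Qed.

(** Chernoff: on [X t w <= a] the variable exp(lambda (a - X_t)) is at least 1, and its mean is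
    controlled by a Laplace exponent of at least [M]. *)
Lemma survival_le_exp (M : R) : exists2 lambda : R, 0 < lambda &
  forall a t, 0 <= t -> (survival X a t <= (expR (lambda * a - M * t))%:E)%E.
Proof.
have [lambda l0 lM] := laplace_exponent_unbounded M.
exists lambda => // a t t0.
have mA := measurable_survival X a t.
have mexp : measurable_fun setT (fun w => (expR (- (lambda * X t w)))%:E).
  apply/measurable_EFinP; apply: measurableT_comp => //.
  by apply: measurableT_comp => //; exact: measurable_funM.
have lap := subordinator_laplace hX t0 l0.
rewrite (_ : lambda * a - M * t = - - (lambda * a) - M * t); last by ring.
rewrite expRD [X in (X * _)%:E]expRN EFinM.
rewrite -lee_pdivrMl ?invr_gt0 ?expR_gt0// invrK.
apply: (@le_trans _ _
    (\int[P]_(w in [set w | (X t w <= a)%R]) (expR (- (lambda * X t w)))%:E)%E).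
  rewrite -integral_cst//; apply: ge0_le_integral => //.
  - by move=> w _; rewrite lee_fin expR_ge0.
  - by apply: measurable_funS mexp.
  - by move=> w /= wa; rewrite lee_fin ler_expR lerN2 ler_pM2l.
apply: (@le_trans _ _ (\int[P]_w (expR (- (lambda * X t w)))%:E)%E).
  by apply: ge0_subset_integral => // w _; rewrite lee_fin expR_ge0.
move: lap; rewrite unlock => ->.
rewrite -[leRHS]/(expeR (- (M * t))%:E) lee_expeR EFinN leeN2 mulrC EFinM.
by rewrite lee_wpmul2l// lee_fin.
Qed.

End laplace_bound.

Lemma geometric_sum_le (R : realType) (q : R) (N : nat) : 0 <= q -> q < 1 ->
  \sum_(0 <= n < N) q ^+ n <= (1 - q)^-1.
Proof.
move=> q0 q1; have q1' : 0 < 1 - q by lra.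
suff -> : \sum_(0 <= n < N) q ^+ n = (1 - q ^+ N) / (1 - q).
  by rewrite ler_pdivrMr// mulVf ?gt_eqF// lerBlDr lerDl exprn_ge0.
elim: N => [|N IH]; first by rewrite big_nil expr0 subrr mul0r.
by rewrite big_nat_recr//= IH exprS; field; rewrite gt_eqF.
Qed.

(** * Finiteness, continuity and positivity of U *)

Section potential_function.
Context (disp : measure_display) (T : measurableType disp) (R : realType)
  (P : probability T R) (X : R -> {RV P >-> R}).
Hypothesis hX : levy_process X.
Hypothesis X_nd :
  {ae P, forall w, forall s t : R, 0 <= s -> s <= t -> X s w <= X t w}.
Hypothesis survival_exp : forall M : R, exists2 lambda : R, 0 < lambda &
  forall a t, 0 <= t -> (survival X a t <= (expR (lambda * a - M * t))%:E)%E.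

(** Since [M * h >= 1], the n-th term is at most exp(lambda a) exp(-n), and exp(-1) <= 1/2 gives a
    geometric series of sum 2. *)
Lemma walk_mass_le (h : R) : 0 < h -> forall M : R, h^-1 <= M ->
  forall lambda, (forall a t, 0 <= t ->
    (survival X a t <= (expR (lambda * a - M * t))%:E)%E) ->
  forall a, (walk_mass P (increment X h) a <= (2 * expR (lambda * a))%:E)%E.
Proof.
move=> h0 M hM lambda hl a; rewrite walk_mass_survival//.
have S0 n : (0 <= survival X a (n%:R * h))%E by exact: survival_ge0.
apply: lime_le; first by apply: is_cvg_nneseries => n _ _; exact: S0.
apply: nearW => N.
apply: (@le_trans _ _ (\sum_(0 <= n < N)
    (expR (lambda * a) * 2^-1 ^+ n)%:E)%E).
  apply: lee_sum => n _; apply: le_trans (hl _ _ _) _.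
    by rewrite mulr_ge0// ltW.
  rewrite lee_fin expRD ler_pM2l ?expR_gt0//.
  apply: (@le_trans _ _ (expR (-1) ^+ n)); last first.
    by rewrite lerXn2r ?nnegrE ?expR_ge0 ?invr_ge0// expRN1_le.
  rewrite -expRM_natl ler_expR mulrN1 lerN2 mulrCA -[leLHS]mulr1 ler_wpM2l//.
  by rewrite -ler_pdivrMr// mul1r.
rewrite sumEFin lee_fin -mulr_sumr mulrC ler_wpM2r ?expR_ge0//.
rewrite [leRHS](_ : _ = (1 - 2^-1)^-1); last by field.
by apply: geometric_sum_le; lra.
Qed.

Lemma walk_mass_fin h a : 0 < h -> (walk_mass P (increment X h) a < +oo)%E.
Proof.
move=> h0; have [lambda l0 hl] := survival_exp h^-1.
by apply: le_lt_trans (walk_mass_le h0 (lexx _) hl a) _; rewrite ltry.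
Qed.

Definition upot (a : R) : R := fine (potential X a).

Lemma potential_ge0 a : (0 <= potential X a)%E.
Proof. by apply: integral_ge0 => t _; exact: measure_ge0. Qed.

Lemma potential_fin a : (potential X a < +oo)%E.
Proof.
have [h _] := potential_walk_mass hX X_nd a (@ltr01 R).
by apply: le_lt_trans h _; rewrite mul1e walk_mass_fin.
Qed.

Lemma upotE a : potential X a = (upot a)%:E.
Proof. by rewrite /upot fineK// ge0_fin_numE ?potential_ge0// potential_fin. Qed.

Lemma upot_ge0 a : 0 <= upot a.
Proof. by rewrite fine_ge0// potential_ge0. Qed.

Lemma upot_homo : {homo upot : a b / a <= b}.
Proof.
move=> a b ab; rewrite -lee_fin -!upotE; apply: ge0_le_integral.
- exact: measurable_itv.
- by move=> t _; exact: measure_ge0.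
- exact: measurable_survival_time.
- exact: measurable_survival_time.
- by move=> t _; exact: survival_homo.
Qed.

Definition mass (h a : R) : R := fine (walk_mass P (increment X h) a).

Lemma massE h a : 0 < h -> walk_mass P (increment X h) a = (mass h a)%:E.
Proof.
move=> h0; rewrite /mass fineK// ge0_fin_numE ?walk_mass_fin//.
by apply: nneseries_ge0 => n _ _; exact: measure_ge0.
Qed.

Lemma upot_mass h a : 0 < h -> upot a <= h * mass h a <= h + upot a.
Proof.
move=> h0; have [h1 h2] := potential_walk_mass hX X_nd a h0.
by move: h1 h2; rewrite massE// upotE -EFinM -EFinD !lee_fin => -> ->.
Qed.

Lemma survival_small h e : 0 < h -> 0 < e ->
  exists2 b, 0 < b & fine (survival X b h) <= e.
Proof.
(* With [b = lambda^-1] the exponent is [1 - (1 - ln e) = ln e]. *)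
move=> h0 e0; have [lambda l0 hl] := survival_exp ((1 - ln e) / h).
exists lambda^-1; first by rewrite invr_gt0.
rewrite -lee_fin fineK ?survival_fin_num//.
apply: le_trans (hl _ _ (ltW h0)) _.
rewrite mulfV ?gt_eqF// divfK ?gt_eqF// opprB addrC subrK lee_fin lnK//.
Qed.

Lemma upot_small e : 0 < e -> exists2 b, 0 < b & upot b <= e.
Proof.
(* At mesh [M^-1] and level [lambda^-1], [walk_mass_le] bounds the potential by
   [M^-1 * (2 * expR 1)], which is [e]. *)
move=> e0; pose M := 2 * expR 1 / e.
have M0 : 0 < M by rewrite divr_gt0// mulr_gt0// expR_gt0.
have [lambda l0 hl] := survival_exp M.
exists lambda^-1; first by rewrite invr_gt0.
have h0 : 0 < M^-1 by rewrite invr_gt0.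
have /andP[uh _] := upot_mass (lambda^-1) h0.
apply: le_trans uh _.
have := walk_mass_le h0 _ hl lambda^-1; rewrite invrK => /(_ (lexx _)).
rewrite massE// lee_fin mulfV ?gt_eqF// => h.
apply: le_trans (ler_wpM2l (ltW h0) h) _.
by rewrite /M invf_div -mulrA mulVf ?mulr1// gt_eqF// mulr_gt0// expR_gt0.
Qed.

(** [walk_mass_step] times [h]. One [h] comes from its zeroth term, the other from the Riemann sum
    error at [a]. *)
Lemma upot_step (h a b : R) : 0 < h ->
  upot (a + b) * (1 - fine (survival X b h)) <= upot a + 2 * h.
Proof.
move=> h0; set p := fine _.
have p1 : p <= 1.
  by rewrite -lee_fin fineK ?survival_fin_num// survival_le1.
have := walk_mass_step hX X_nd a b h0.
rewrite !massE// -[survival _ _ _]fineK ?survival_fin_num// -/p.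
rewrite -EFinM -!EFinD lee_fin => step.
have /andP[u1 _] := upot_mass (a + b) h0.
have /andP[_ u2] := upot_mass a h0.
have p0 : 0 <= 1 - p by rewrite subr_ge0.
have := ler_wpM2r p0 u1.
have := ler_wpM2l (ltW h0) step.
nra.
Qed.

Lemma upot_uniform (K e : R) : 0 < e -> exists2 b, 0 < b &
  forall x y, y <= K -> x <= y -> y <= x + b -> upot y <= upot x + e.
Proof.
(* Half of [e] pays for [2 * h], the other half for [survival X b h] times [upot y], where
   [upot y <= upot K]. *)
move=> e0; pose h := e / 4.
have h0 : 0 < h by rewrite divr_gt0.
have UK := upot_ge0 K.
have UK1 : 0 < 2 * (upot K + 1) by lra.
have [b b0 pb] := survival_small h0 (divr_gt0 e0 UK1).
exists b => // x y yK xy yxb.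
have := upot_step (y - b) b h0; rewrite subrK.
move: pb; set p := fine _; rewrite ler_pdivlMr// => pb st.
have uy := upot_homo yK.
have uyb : upot (y - b) <= upot x by apply: upot_homo; lra.
have p0 : 0 <= p by rewrite fine_ge0// survival_ge0.
have := ler_wpM2l p0 uy.
have : 2 * h = e / 2 by rewrite /h; field.
have := upot_ge0 x; nra.
Qed.

Lemma upot_continuous : continuous upot.
Proof.
move=> x; apply/cvgrPdist_le => e e0.
have [b b0 ub] := upot_uniform (x + 1) e0.
near=> y.
have xy : `|x - y| < Num.min b 1.
  by near: y; apply: cvgr_dist_lt => //; rewrite lt_min b0 ltr01.
have /andP[xyb xy1] : (`|x - y| < b) && (`|x - y| < 1) by rewrite -lt_min.
move: xyb xy1; rewrite !ltr_norml => /andP[b1 b2] /andP[b3 b4].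
rewrite ler_norml.
have [le_xy|/ltW le_yx] := leP x y.
  have := ub x y; have := upot_homo le_xy.
  by move=> h1 /(_ ltac:(lra) le_xy ltac:(lra)) h2; apply/andP; split; lra.
have := ub y x; have := upot_homo le_yx.
by move=> h1 /(_ ltac:(lra) le_yx ltac:(lra)) h2; apply/andP; split; lra.
Unshelve. all: by end_near. Qed.

Lemma upot0 : upot 0 = 0.
Proof.
apply/eqP; rewrite eq_le upot_ge0 andbT; apply/ler_addgt0Pr => e e0.
have [b b0 ub] := upot_small e0; rewrite add0r; apply: le_trans ub.
by apply: upot_homo; exact: ltW.
Qed.

(* If [upot a = 0] then [X h > a] almost surely for all [h > 0], against right
   continuity at [0]. *)
Lemma upot_gt0 a : 0 < a -> 0 < upot a.
Proof.
move=> a0; rewrite lt_neqAle upot_ge0 andbT eq_sym; apply/negP => /eqP u0.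
have S0 : survival X a 0 = 1%E.
  apply/eqP; rewrite eq_le survival_le1/= -(probability_setT P).
  apply: measure_le_ae => //; first exact: measurable_survival.
  case: (levy_start hX) => N [mN N0 hN]; exists N; split => // w /= nw.
  by apply: hN => /= X0; apply: nw => _; rewrite X0 ltW.
have Sh h : 0 < h -> survival X a h = 0%E.
  move=> h0; have /andP[_] := upot_mass a h0.
  rewrite u0 addr0 -[leRHS]mulr1 ler_pM2l// -lee_fin -massE//.
  rewrite walk_mass_survival// => le1; apply/eqP.
  rewrite eq_le survival_ge0 andbT.
  (* The term at time 0 already exhausts the total mass 1, so the term at time [h] vanishes. *)
  have : (\sum_(0 <= n < 2) survival X a (n%:R * h) <= 1)%E.
    apply: le_trans le1; apply: nneseries_lim_ge => n _ _.
    exact: survival_ge0.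
  rewrite big_nat_recr//= big_nat1 mul0r mul1r S0.
  by rewrite -[leRHS]adde0 leeD2lE.
have large n : {ae P, forall w, ~ X n.+1%:R^-1 w <= a}.
  exists [set w | X n.+1%:R^-1 w <= a]; split.
  - exact: measurable_survival.
  - by apply: Sh; rewrite invr_gt0.
  - by move=> w /= /contrapT.
have /ae_foralln large' := large.
have : {ae P, forall w : T, False}.
  have rc := levy_right_continuous hX; have st := levy_start hX.
  apply: filterS3 large' rc st => w lw rcw stw.
  have := rcw 0 (lexx _); rewrite stw => /cvgr_lt/(_ a a0)[e /= e0 he].
  have [n ne] : exists n : nat, n.+1%:R^-1 < e.
    exists (Num.truncn e^-1); rewrite invf_plt ?posrE// truncnS_gt//.
  apply: (lw n); apply/ltW/he; last by rewrite invr_gt0.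
  by rewrite /= sub0r normrN gtr0_norm ?invr_gt0.
move=> ae_false.
have : (P setT <= P set0)%E.
  by apply: measure_le_ae => //; apply: filterS ae_false.
by rewrite measure0 probability_setT lee_fin ler10.
Qed.

Lemma upot_value v : 0 < v -> v <= upot 1 -> exists2 a, 0 < a & upot a = v.
Proof.
move=> v0 v1.
have [||c] := @IVT R upot 0 1 v ler01.
- by apply: continuous_subspaceT; exact: upot_continuous.
- by rewrite upot0 min_l ?max_r ?upot_ge0// ltW.
rewrite in_itv/= => /andP[c0 _] uc; exists c => //.
by rewrite lt_neqAle c0 andbT; apply: contraTneq v0 => c0'; rewrite -uc -c0' upot0 ltxx.
Qed.

End potential_function.

(** * Covering the range of a subordinator *)

Section grid.
Context (R : realType) (f : R -> R) (t : R).
Hypothesis t_gt0 : 0 < t.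
Hypothesis f_nd : forall s u, 0 <= s -> s <= u -> f s <= f u.
Hypothesis f_rc : forall s, 0 <= s -> f u @[u --> s^'+] --> f s.

(* The least grid time above [q], except that [t] itself is kept. *)
Definition grid_index (n : nat) (q : R) : nat :=
  minn n (Num.truncn (q * n%:R / t)).+1.

Lemma grid_index_itv n q : (0 < n)%N -> 0 <= q <= t ->
  q <= (grid_index n q)%:R * (t / n%:R) <= q + t / n%:R.
Proof.
move=> n0 /andP[q0 qt]; have n0' : 0 < n%:R :> R by rewrite ltr0n.
set h := t / n%:R; have h0 : 0 < h by rewrite divr_gt0.
have qE : q = (q * n%:R / t) * h by rewrite /h; field; rewrite !gt_eqF.
have nh : n%:R * h = t by rewrite /h; field; rewrite gt_eqF.
have x0 : 0 <= q * n%:R / t by rewrite divr_ge0 ?mulr_ge0// ltW.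
have := truncn_itv x0.
rewrite /grid_index; set x := q * _ / t in qE *.
set k := Num.truncn x => /andP[kx xk].
have kh : k.+1%:R * h <= q + h by rewrite -natr1 mulrDl mul1r lerD2r qE ler_pM2r.
have hk : q <= k.+1%:R * h by rewrite qE ler_pM2r// ltW.
rewrite minnE; have [nk|nk] := leqP n k.+1.
  rewrite (_ : (n - (n - k.+1))%N = n); last by lia.
  rewrite nh qt/=; apply: le_trans kh; rewrite -nh ler_pM2r// ler_nat//.
by rewrite (_ : (n - (n - k.+1))%N = k.+1) ?hk//; lia.
Qed.

Lemma grid_approx q c : 0 <= q <= t -> f q < c ->
  exists K : nat, forall n, (K <= n)%N -> (0 < n)%N ->
    f ((grid_index n q)%:R * (t / n%:R)) < c.
Proof.
move=> qt fqc; have /andP[q0 _] := qt.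
have /cvgr_lt/(_ c fqc)[e /= e0 he] := f_rc q0.
exists (Num.truncn (t / e)).+1 => n Kn n0.
have n0' : 0 < n%:R :> R by rewrite ltr0n.
have := grid_index_itv n0 qt; set u := _ * _ => /andP[qu uq].
have te : t / n%:R < e.
  rewrite ltr_pdivrMr// mulrC -ltr_pdivrMr//.
  by apply: lt_le_trans (truncnS_gt _) _; rewrite ler_nat.
move: qu; rewrite le_eqVlt => /predU1P[<-//|qu].
by apply: he => //=; rewrite ltr0_norm; lra.
Qed.

(** Times are rounded up to the grid. Values then only increase, and by right continuity the
    increase of the lower point eventually fits into the strict gap. *)
Lemma grid_separated (delta x : R) (l : seq R) : path (separated delta) x l ->
  (forall z, z \in x :: l -> [set f s | s in `[0, t]] z) ->
  exists K : nat, forall n, (K <= n)%N -> (0 < n)%N ->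
  exists x' l', [/\ path (separated delta) x' l', size l' = size l &
    forall z, z \in x' :: l' -> exists2 i, (i <= n)%N & z = f (i%:R * (t / n%:R))].
Proof.
move=> xl lA.
have /choice[q qP] z : exists q,
    [set f s | s in `[0, t]] z -> 0 <= q <= t /\ f q = z.
  have [[s s0 <-]|h] := pselect ([set f s | s in `[0, t]] z).
    by exists s => _; split => //; move: s0; rewrite /= in_itv.
  by exists 0.
pose r n z := f ((grid_index n (q z))%:R * (t / n%:R)).
suff [K hK] : exists K : nat, forall n, (K <= n)%N -> (0 < n)%N ->
    path (separated delta) (r n x) (map (r n) l).
  exists K => n Kn n0; exists (r n x), (map (r n) l); split.
  - exact: hK.
  - by rewrite size_map.
  move=> z; rewrite -map_cons => /mapP[z' _ ->].
  by exists (grid_index n (q z')) => //; exact: geq_minl.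
elim: l x xl lA => [|y l IH] x /=; first by exists 0%N.
move=> /andP[xy yl] lA.
have [K hK] := IH y yl (fun z zl => lA z (mem_behead (s := x :: _) zl)).
have [qx fqx] := qP x (lA x (mem_head _ _)).
have [qy fqy] : 0 <= q y <= t /\ f (q y) = y.
  by apply: qP; apply: lA; rewrite !inE eqxx orbT.
have [|K' hK'] := grid_approx (c := y - delta) qx.
  by rewrite fqx; move: xy; rewrite /separated/=; lra.
exists (maxn K K') => n; rewrite geq_max => /andP[Kn K'n] n0.
rewrite hK// andbT /separated/=.
have := hK' n K'n n0; rewrite -/(r n x) => rx.
have : y <= r n y.
  have /andP[qy0 _] := qy; have /andP[yg _] := grid_index_itv n0 qy.
  by rewrite -{1}fqy; apply: f_nd.
lra.
Qed.

End grid.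

(** * Concentration of N(t, delta) at a fixed delta *)

Section concentration.
Context (disp : measure_display) (T : measurableType disp) (R : realType)
  (P : probability T R) (X : R -> {RV P >-> R}).
Hypothesis hX : levy_process X.
Hypothesis X_nd :
  {ae P, forall w, forall s t : R, 0 <= s -> s <= t -> X s w <= X t w}.
Hypothesis survival_exp : forall M : R, exists2 lambda : R, 0 < lambda &
  forall a t, 0 <= t -> (survival X a t <= (expR (lambda * a - M * t))%:E)%E.
Context (t : R).
Hypothesis t_gt0 : 0 < t.

Lemma block_count_deviation (n : nat) (delta e : R) :
  let h := t / n%:R in let S := h * mass X h delta in
  (0 < n)%N -> 0 < delta -> 0 < e ->
  S <= 2 * upot X delta -> 4 * upot X delta <= e * t ->
  (P [set w | (e * t <= `|S * (blocks (increment X h) delta n w).2%:R - t|)%R] <=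
    (16 * upot X delta / (e ^+ 2 * t))%:E)%E.
Proof.
move=> h S n0 d0 e0 Su ut.
have n0' : 0 < n%:R :> R by rewrite ltr0n.
have h0 : 0 < h by rewrite divr_gt0.
have u0 := upot_gt0 hX X_nd survival_exp d0.
have et0 : 0 < e * t by rewrite mulr_gt0.
(* Chosen so that [h * (a + mass X h delta) = e * t]. The hypotheses give [S <= e * t / 2], hence
   the bound 2t(2U) / (e t / 2)^2, where the 16 arises. *)
pose a := (e * t - S) / h.
have a0 : 0 < a by rewrite divr_gt0//; lra.
have := renewal_count_concentration (increment_indep hX h0)
  (fun i B => increment_id hX i h0) (increment_ge0 X_nd h0)
  (fun b => walk_mass_fin hX survival_exp b h0) (ltW d0) n a0.
rewrite -/(mass X h delta) => dev.
have -> : [set w | e * t <=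
      `|S * (blocks (increment X h) delta n w).2%:R - t| ] =
    [set w | a + mass X h delta <=
      `|mass X h delta * (blocks (increment X h) delta n w).2%:R - n%:R| ].
  have key c : (e * t <= `|S * c - t|) =
      (a + mass X h delta <= `|mass X h delta * c - n%:R|).
    rewrite -[RHS](ler_pM2l h0) -[X in _ = (_ <= X * _)](gtr0_norm h0) -normrM.
    have -> : h * (a + mass X h delta) = e * t.
      by rewrite /a /S; field; rewrite gt_eqF.
    have -> // : h * (mass X h delta * c - n%:R) = S * c - t.
    by rewrite /S /h; field; rewrite gt_eqF.
  by apply/seteqP; split => w /=; rewrite key.
apply: le_trans dev _; rewrite lee_fin.
have S0 : 0 <= S by have /andP[+ _] := upot_mass hX X_nd survival_exp delta h0;
  apply: le_trans; exact: ltW.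
have -> : 2 * n%:R * mass X h delta / a ^+ 2 = 2 * t * S / (e * t - S) ^+ 2.
  rewrite /a (_ : n%:R = t / h); last by rewrite /h; field; rewrite !gt_eqF.
  have : e * t - S != 0 by rewrite gt_eqF//; lra.
  by rewrite /S => nz; field; rewrite nz gt_eqF.
have eS : e * t / 2 <= e * t - S by lra.
apply: (@le_trans _ _ (2 * t * (2 * upot X delta) / (e * t / 2) ^+ 2)).
  apply: ler_pM.
  - by rewrite mulr_ge0// mulr_ge0// ltW.
  - by rewrite invr_ge0 sqr_ge0.
  - by rewrite ler_pM2l// mulr_gt0.
  - have et2 : 0 < e * t / 2 by rewrite divr_gt0.
    rewrite lef_pV2 ?posrE ?exprn_gt0//; last by lra.
    by rewrite lerXn2r// nnegrE; lra.
rewrite le_eqVlt; apply/orP; left; apply/eqP; field.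
by rewrite !gt_eqF.
Qed.

(** Grid values lie in the range, so a single mesh gives the lower bound; the upper bound needs all
    fine meshes. Each side has an exceptional set of probability at most half the stated bound. *)
Lemma covering_concentration (delta e : R) :
  0 < delta -> 0 < e -> e <= 1 -> 4 * upot X delta <= e * t ->
  exists B : set T, [/\ measurable B,
    (P B <= (32 * upot X delta / (e ^+ 2 * t))%:E)%E &
    {ae P, forall w, ~ B w ->
      (((1 - e) * t)%:E <=
        (1 + e)%:E * ((upot X delta)%:E * range_covering_number X t delta w) /\
      (upot X delta)%:E * range_covering_number X t delta w <=
        ((1 + e) * t + upot X delta)%:E)%E}].
Proof.
move=> d0 e0 e1 ut; set u := upot X delta; set N := range_covering_number X t delta.
have u0 : 0 < u := upot_gt0 hX X_nd survival_exp d0.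
pose h n := t / n%:R.
pose C n w : R := (blocks (increment X (h n)) delta n w).2%:R.
pose S n := h n * mass X (h n) delta.
have mC n : measurable_fun setT (C n) by exact: measurable_block_count.
(* From [K0] on the mesh is at most [e * u], so [S n] exceeds [u] by a factor of at most [1 + e]. *)
pose K0 := (Num.truncn (t / (e * u))).+1.
have h0 n : (0 < n)%N -> 0 < h n by move=> n0; rewrite divr_gt0// ltr0n.
have hu n : (K0 <= n)%N -> h n <= e * u.
  move=> Kn; have n0 : 0 < n%:R :> R by rewrite ltr0n; apply: leq_trans Kn.
  rewrite ler_pdivrMr// mulrC -ler_pdivrMr ?mulr_gt0//.
  by apply: ltW; apply: lt_le_trans (truncnS_gt _) _; rewrite ler_nat.
have SU n : (K0 <= n)%N -> u <= S n <= (1 + e) * u.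
  move=> Kn; have n0 : (0 < n)%N by apply: leq_trans Kn.
  have /andP[-> S2] := upot_mass hX X_nd survival_exp delta (h0 n n0).
  by apply: le_trans S2 _; have := hu n Kn; rewrite -/u; lra.
have dev n : (K0 <= n)%N ->
    (P [set w | (e * t <= `|S n * C n w - t|)%R] <=
      (16 * u / (e ^+ 2 * t))%:E)%E.
  move=> Kn; apply: block_count_deviation => //; first exact: leq_trans Kn.
  have /andP[_ S2] := SU n Kn; apply: le_trans S2 _.
  by rewrite ler_wpM2r ?(ltW u0)//; lra.
have mdev n : measurable [set w | e * t <= `|S n * C n w - t| ].
  rewrite -[[set _ | _]]setTI; apply: measurable_fun_le => //.
  apply: measurableT_comp => //; apply: measurable_funB => //.
  exact: measurable_funM.
pose E n := [set w | (1 + e) * t <= u * C n w].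
have mE n : measurable (E n).
  rewrite -[E n]setTI; apply: measurable_fun_le => //.
  exact: measurable_funM.
have PE n : (K0 <= n)%N -> (P (E n) <= (16 * u / (e ^+ 2 * t))%:E)%E.
  move=> Kn; apply: le_trans _ (dev n Kn); apply: le_measure; rewrite ?inE//.
  move=> w; rewrite /E/= => Ew; apply: le_trans (ler_norm _).
  have /andP[S1 _] := SU n Kn.
  have : u * C n w <= S n * C n w by rewrite ler_wpM2r.
  lra.
(* [N > m] gives [C n >= m] only for all large [n], hence a limit inferior. *)
pose F K := \bigcap_(n in [set n | (K <= n)%N /\ (K0 <= n)%N]) E n.
have mF K : measurable (F K).
  apply: bigcap_measurable => //.
  by exists (maxn K K0); split; [exact: leq_maxl|exact: leq_maxr].
pose B1 := \bigcup_K F K.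
have mB1 : measurable B1 by exact: bigcupT_measurable.
have PB1 : (P B1 <= (16 * u / (e ^+ 2 * t))%:E)%E.
  have ndF : nondecreasing_seq F.
    move=> m n mn; apply/subsetPset => w Fw k /= [nk Kk]; apply: Fw; split => //.
    exact: leq_trans nk.
  have cvF := nondecreasing_cvg_mu (mu := P) mF mB1 ndF.
  rewrite -(cvg_lim _ cvF)//; apply: lime_le; first by apply/cvg_ex; exists (P B1).
  apply: nearW => K; apply: le_trans _ (PE (maxn K K0) (leq_maxr _ _)).
  apply: le_measure; rewrite ?inE// => w; apply.
  by split; [exact: leq_maxl|exact: leq_maxr].
pose B2 := [set w | e * t <= `|S K0 * C K0 w - t| ].
exists (B1 `|` B2); split.
- exact: measurableU mB1 (mdev K0).
- apply: le_trans (measureU2 P mB1 (mdev K0)) _.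
  apply: le_trans (leeD PB1 (dev K0 (leqnn _))) _.
  by rewrite -EFinD lee_fin -mulrDl; lra.
apply: filterS2 X_nd (levy_right_continuous hX) => w ndw rcw.
rewrite -[~ _]/((~` (B1 `|` B2)) w) setCU => -[nB1 nB2].
have snd n : (0 < n)%N -> nondecreasing_seq (fun i : nat => X (i%:R * h n) w).
  move=> n0 i j ij; apply: ndw; first by rewrite mulr_ge0// ltW// h0.
  by rewrite ler_pM2r ?h0// ler_nat.
split.
  have /andP[_ S2] := SU K0 (leqnn _).
  have C0 : (1 - e) * t <= (1 + e) * (u * C K0 w).
    have : S K0 * C K0 w <= (1 + e) * u * C K0 w by rewrite ler_wpM2r.
    move/negP: nB2; rewrite -ltNge ltr_norml => /andP[+ _]; lra.
  apply: (@le_trans _ _ ((1 + e) * (u * C K0 w))%:E); first by rewrite lee_fin.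
  rewrite !EFinM lee_pmul2l ?lte_fin//; last by lra.
  rewrite lee_pmul2l ?lte_fin//.
  have K0n : 0 < K0%:R :> R by rewrite ltr0n.
  have hA i : (i <= K0)%N -> [set X s w | s in `[0, t]] (X (i%:R * h K0) w).
    move=> iK; exists (i%:R * h K0) => //=; rewrite in_itv/=; apply/andP; split.
      by rewrite mulr_ge0// ltW// h0.
    by rewrite /h mulrA ler_pdivrMr// mulrC ler_pM2l// ler_nat.
  have := @blocks_lt_covering_number _ _ _ (increment X (h K0)) delta w
    (fun i => X (i%:R * h K0) w) (ltW d0) (snd K0 isT) (fun n => erefl) K0 _ hA.
  by apply: le_trans; rewrite lee_fin ler_nat.
(* Large enough that [m] blocks put the path in [E n]; rounding up costs the extra [u] of the
   conclusion. *)
pose m := (Num.truncn ((1 + e) * t / u)).+1.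
have mx : (1 + e) * t / u < m%:R by exact: truncnS_gt.
have mu : u * m%:R <= (1 + e) * t + u.
  have x0 : 0 <= (1 + e) * t / u.
    by rewrite divr_ge0 ?(ltW u0)// mulr_ge0 ?(ltW t_gt0)//; lra.
  have /andP[kx _] := truncn_itv x0.
  rewrite /m -natr1 mulrDr mulr1 lerD2r.
  by rewrite mulrC -ler_pdivlMr.
apply: (@le_trans _ _ (u%:E * m%:R%:E)%E); last by rewrite -EFinM lee_fin.
rewrite lee_pmul2l ?lte_fin//; apply: covering_number_le; apply: contrapT => nA.
have lbA : has_lbound [set X s w | s in `[0, t]].
  exists (X 0 w) => _ [s /= + <-]; rewrite in_itv/= => /andP[s0 _].
  exact: ndw.
have [x [l [xl lm lA]]] := separated_of_uncoverable (ltW d0) lbA nA.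
have [K hK] := grid_separated t_gt0 ndw rcw xl lA.
apply: nB1; exists K => // n [Kn K0n].
have n0 : (0 < n)%N by exact: leq_trans K0n.
have [x' [l' [xl' ll' lA']]] := hK n Kn n0.
have := separated_le_blocks (xi := increment X (h n))
  (ltW d0) (snd n n0) (fun n => erefl) xl' lA'.
rewrite ll' lm -(ler_nat R) => mCn.
rewrite /E/=; apply: le_trans (ler_wpM2l (ltW u0) mCn).
by rewrite [leRHS]mulrC -ler_pdivrMr// ltW.
Qed.

End concentration.

(** * Borel-Cantelli and interpolation in delta *)

Section almost_sure.
Context (disp : measure_display) (T : measurableType disp) (R : realType)
  (P : probability T R) (X : R -> {RV P >-> R}).
Hypothesis hX : levy_process X.
Hypothesis X_nd :
  {ae P, forall w, forall s t : R, 0 <= s -> s <= t -> X s w <= X t w}.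
Hypothesis survival_exp : forall M : R, exists2 lambda : R, 0 < lambda &
  forall a t, 0 <= t -> (survival X a t <= (expR (lambda * a - M * t))%:E)%E.
Context (t : R).
Hypothesis t_gt0 : 0 < t.

Lemma borel_cantelli_ae (B : nat -> set T) :
  (forall n, measurable (B n)) -> (\sum_(n <oo) P (B n) < +oo)%E ->
  {ae P, forall w, exists I, forall i, (I <= i)%N -> ~ B i w}.
Proof.
move=> mB PB; exists (lim_sup_set B); split.
- by apply: bigcap_measurable => // k _; exact: bigcup_measurable.
- exact: lim_sup_set_cvg0.
move=> w /= h I _; apply: contrapT => nB; apply: h; exists I => i Ii Bi.
by apply: nB; exists i.
Qed.

Lemma potential_covering_eventually (e : R) : 0 < e -> e <= 1 ->
  {ae P, forall w, exists2 r, 0 < r & forall delta, 0 < delta -> delta < r ->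
    (((1 - e) * t)%:E <=
      ((1 + e) ^+ 3)%:E * ((upot X delta)%:E * range_covering_number X t delta w) /\
    (upot X delta)%:E * range_covering_number X t delta w <=
      ((1 + e) ^+ 2 * (1 + 2 * e) * t)%:E)%E}.
Proof.
move=> e0 e1; set u := upot X; set N := range_covering_number X t.
have ep : 0 < 1 + e by lra.
pose q := (1 + e)^-1.
have q0 : 0 < q by rewrite invr_gt0.
have q1 : q < 1 by rewrite invf_lt1//; lra.
(* The first bound makes the values attainable by [upot_value], the second is the smallness that
   [covering_concentration] requires. *)
pose v0 := Num.min (u 1) (e * t / 4).
have v00 : 0 < v0.
  rewrite lt_min (upot_gt0 hX X_nd survival_exp ltr01)/=.
  by rewrite divr_gt0// mulr_gt0.
pose v i := v0 * q ^+ i.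
have v_gt0 i : 0 < v i by rewrite mulr_gt0// exprn_gt0.
have vS i : v i = (1 + e) * v i.+1.
  by rewrite /v exprS /q; field; rewrite gt_eqF// expf_neq0.
have vSS i : v i = (1 + e) ^+ 2 * v i.+2.
  by rewrite vS [v i.+1]vS expr2 mulrA.
have v_le i : v i <= v0.
  by rewrite -[leRHS]mulr1 ler_pM2l// exprn_ile1// ltW.
have /choice[D DP] i : exists a, 0 < a /\ u a = v i.
  have [|a a0 ua] := upot_value hX X_nd survival_exp (v_gt0 i).
    by apply: le_trans (v_le i) _; rewrite ge_min lexx.
  by exists a.
have D0 i : 0 < D i by have [] := DP i.
have uD i : u (D i) = v i by have [] := DP i.
have ve i : 4 * v i <= e * t.
  have : v i <= e * t / 4 by apply: le_trans (v_le i) _; rewrite ge_min lexx orbT.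
  by lra.
have conc i : exists B : set T, [/\ measurable B,
    (P B <= (32 * v i / (e ^+ 2 * t))%:E)%E &
    {ae P, forall w, ~ B w ->
      (((1 - e) * t)%:E <= (1 + e)%:E * ((v i)%:E * N (D i) w) /\
      (v i)%:E * N (D i) w <= ((1 + e) * t + v i)%:E)%E}].
  rewrite -uD; apply: covering_concentration => //.
  by rewrite -/u uD; exact: ve.
have /choice[B BP] := conc.
have mB i : measurable (B i) by have [] := BP i.
have PB i : (P (B i) <= (32 * v i / (e ^+ 2 * t))%:E)%E by have [] := BP i.
have BCV : (\sum_(n <oo) P (B n) < +oo)%E.
  apply: (@le_lt_trans _ _ (32 * v0 / (e ^+ 2 * t) * (1 - q)^-1)%:E); last first.
    by rewrite ltry.
  apply: lime_le; first by apply: is_cvg_nneseries.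
  apply: nearW => n; apply: le_trans (lee_sum _ (fun i _ => PB i)) _.
  rewrite sumEFin lee_fin.
  rewrite (eq_bigr (fun i => 32 * v0 / (e ^+ 2 * t) * q ^+ i)); last first.
    by move=> i _; rewrite /v mulrA; ring.
  rewrite -mulr_sumr ler_wpM2l//; last by apply: geometric_sum_le => //; exact: ltW.
  by rewrite divr_ge0// mulr_ge0// ?sqr_ge0// ltW.
have aeB := ae_foralln (fun i => let: And3 _ _ h := BP i in h).
apply: filterS2 (borel_cantelli_ae mB BCV) aeB => w [I hI] hw.
exists (D I.+1) => // delta d0 dD.
have ud : 0 < u delta := upot_gt0 hX X_nd survival_exp d0.
have uI : u delta < v I.
  apply: (@le_lt_trans _ _ (v I.+1)).
    by rewrite -uD; apply: upot_homo => //; exact: ltW.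
  by rewrite [ltRHS]vS ltr_pMl//; lra.
have exk : exists k, v k <= u delta.
  have qn : `|q| < 1 by rewrite gtr0_norm.
  have /cvgr_lt/(_ (u delta / v0)) := cvg_expr qn.
  rewrite divr_gt0// => /(_ isT) [K _ /(_ K (leqnn K))] /= qK.
  by exists K; rewrite /v mulrC -ler_pdivlMr// ltW.
have [k vk kmin] := ex_minnP exk.
have Ik : (I < k)%N.
  rewrite ltnNge; apply/negP => kI; move: uI; apply/negP; rewrite -leNgt.
  apply: le_trans vk; rewrite ler_pM2l// ler_wiXn2l// ltW//.
case: k vk kmin Ik => // j vk kmin; rewrite ltnS => Ij.
have uj : u delta < v j by rewrite ltNge; apply/negP => /kmin; rewrite ltnn.
(* Comparing arguments through [u] needs a strict inequality, and [v j.+1 <= u delta] may be an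
   equality. Going to [j.+2] costs one more factor [1 + e]. *)
have uj2 : v j.+2 < u delta.
  by apply: lt_le_trans vk; rewrite [ltRHS]vS ltr_pMl//; lra.
have mono a b : u a < u b -> a <= b.
  move=> uab; rewrite leNgt; apply/negP => /ltW.
  by move/(upot_homo hX X_nd survival_exp); rewrite leNgt uab.
have Nj : (N (D j) w <= N delta w)%E.
  by apply: covering_number_nonincreasing; apply: mono; rewrite uD.
have Nj2 : (N delta w <= N (D j.+2) w)%E.
  by apply: covering_number_nonincreasing; apply: mono; rewrite uD.
have N0 a : (0 <= N a w)%E by exact: covering_number_ge0.
have [lo _] := hw j (hI j Ij).
have [_ up] := hw j.+2 (hI j.+2 (leq_trans Ij (leqW (leqnSn j)))).
split.
  apply: le_trans lo _.
  rewrite (_ : (1 + e) ^+ 3 = (1 + e) * (1 + e) ^+ 2); last by rewrite exprS.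
  rewrite [X in (_ <= X * _)%E]EFinM -[leRHS]muleA lee_pmul2l ?lte_fin//.
  rewrite vSS.
  rewrite [X in (X * _ <= _)%E]EFinM -[leLHS]muleA.
  rewrite lee_pmul2l ?lte_fin ?exprn_gt0//.
  by apply: lee_pmul => //; rewrite lee_fin ltW.
apply: (@le_trans _ _ ((v j)%:E * N (D j.+2) w)%E).
  by apply: lee_pmul => //; rewrite lee_fin ltW.
rewrite vSS.
rewrite [X in (X * _ <= _)%E]EFinM -[leLHS]muleA.
rewrite -[X in (_ <= X%:E)%E]mulrA [leRHS]EFinM lee_pmul2l ?lte_fin ?exprn_gt0//.
apply: le_trans up _; rewrite lee_fin.
have := v_gt0 j.+2; have := ve j.+2; lra.
Qed.

Lemma potential_covering_cvg : {ae P, forall w,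
  (potential X delta * range_covering_number X t delta w)%E
    @[delta --> 0^'+] --> t%:E}.
Proof.
have ev k := potential_covering_eventually (e := k.+1%:R^-1)
  ltac:(by rewrite invr_gt0) ltac:(by rewrite invf_le1// ler1n).
apply: filterS (ae_foralln ev) => w hw.
set g := fun delta : R => (potential X delta * range_covering_number X t delta w)%E.
have g0 delta : (0 <= g delta)%E.
  by rewrite mule_ge0 ?potential_ge0 ?covering_number_ge0.
have gE delta : g delta = ((upot X delta)%:E * range_covering_number X t delta w)%E.
  by rewrite /g upotE.
apply/fine_cvgP; split.
  have [r r0 hr] := hw 0%N.
  exists r => //= delta /= + d0; rewrite sub0r normrN gtr0_norm// => dr.
  rewrite ge0_fin_numE// gE; have [_ h] := hr delta d0 dr.
  by apply: le_lt_trans h _; rewrite ltry.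
apply/cvgrPdist_le => eta eta0.
(* The 11 is 4 + 5 + 2, the sum of the coefficients of (1 + e)^2 (1 + 2e) - 1; it also suffices for
   the lower bound, (1 + e)^3 (1 - 11e) <= 1 - e. *)
pose k := Num.truncn (11 * t / eta).
have [r r0 hr] := hw k.
exists r => //= delta /= + d0; rewrite sub0r normrN gtr0_norm// => dr.
have := hr delta d0 dr; rewrite -gE; set e := k.+1%:R^-1 => -[lo up].
have gfin : g delta \is a fin_num.
  by rewrite ge0_fin_numE//; apply: le_lt_trans up _; rewrite ltry.
move: lo up; rewrite -(fineK gfin) -EFinM !lee_fin /=.
set x := fine _ => lo up.
have x0 : 0 <= x by rewrite fine_ge0.
have e0 : 0 < e by rewrite invr_gt0.
have e1 : e <= 1 by rewrite invf_le1// ler1n.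
have et : 11 * e * t <= eta.
  rewrite /e mulrAC ler_pdivrMr// [leRHS]mulrC -ler_pdivrMr// ltW// truncnS_gt//.
have /andP[e2_ge0 e2_le] : 0 <= e ^+ 2 <= e by rewrite sqr_ge0 expr2 ger_pMr.
have /andP[e3_ge0 e3_le] : 0 <= e ^+ 3 <= e.
  by rewrite exprn_ge0 ?(ltW e0)//= exprS ger_pMr// exprn_ile1// ltW.
have e4 : 0 <= e ^+ 4 by rewrite exprn_ge0// ltW.
have x_le : x <= t + 11 * e * t.
  apply: le_trans up _; rewrite -[X in _ <= X + _]mul1r -mulrDl ler_wpM2r ?(ltW t_gt0)//.
  lra.
have x_ge : t - 11 * e * t <= x.
  have E0 : 0 < (1 + e) ^+ 3 by rewrite exprn_gt0//; lra.
  rewrite -(ler_pM2l E0); apply: le_trans lo.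
  rewrite -[X in X - _]mul1r -mulrBl mulrA ler_wpM2r ?(ltW t_gt0)//.
  lra.
by rewrite ler_norml; apply/andP; split; lra.
Qed.

End almost_sure.

Theorem theorem1 (disp : measure_display) (T : measurableType disp)
    (R : realType) (P : probability T R) (X : R -> {RV P >-> R}) (d : R)
    (Pi : {measure set (measurableTypeR R) -> \bar R})
    (hX : subordinator X d Pi)
    (hPi : Pi `]0, +oo[%classic = +oo%E \/ ((Pi `]0%R, +oo[%classic < +oo)%E /\ 0 < d))
    (t : R) (ht : 0 < t) :
  {ae P, forall w,
    (potential X delta * range_covering_number X t delta w)%E
      @[delta --> 0^'+] --> t%:E}.
Proof.
apply: potential_covering_cvg => //.
- exact: subordinator_levy hX.
- exact: subordinator_nondecreasing hX.
- exact: survival_le_exp hX hPi.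
Qed.
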